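(* Let $p$ be a prime, $K$ a finite extension of $\mathbb{Q}_p$, and $A\subset K((\frac1T))$ a $K$-subalgebra with $A\cap K[[\frac1T]]=K$ and $g:=\dim_KK((\frac1T))/(A+K[[\frac1T]])<\infty$, which is strictly integral. Let $\boldsymbol{\mu}=(\mu_1,\ldots,\mu_g)$ be its gap sequence. Then the map $$\mathcal{M}_K^{\oplus g}\to\Gamma_A,\qquad\vec{\pi}=(\pi_i)_{i=1}^g\mapsto[h_{\boldsymbol{\mu}}(T;\vec{\pi})]$$ is injective.
   Context: $|\cdot|$ is the absolute value on $K$ with $|p|=1/p$, $O_K=\{|a|\le1\}$, $\mathcal{M}_K=\{|a|<1\}$. $K((\frac1T))$ is the field of series $\sum_{i\le n}v_iT^i$; the degree is the largest exponent with nonzero coefficient. Put $\underline{M}(A)=\{\deg v : 0\ne v\in A\}\subset\mathbb{Z}_{\ge0}$, written $\{s_1<s_2<\cdots\}$; the gap sequence is $\mathbb{Z}_{\ge0}\setminus\underline{M}(A)=\{\mu_1<\cdots<\mu_g\}$. The standard basis of $A$ is the unique basis $v_i=\sum_jv_{ij}T^j$ with $v_i$ monic of degree $s_i$ and $v_{i,s_j}=0$ for $i>j\ge1$; $A$ is strictly integral if all $v_{ij}\in O_K$. $H:=\{\sum_{i\in\mathbb{Z}}a_iT^i : a_i\in K,\ \sup|a_i|<\infty,\ \lim_{i\to+\infty}|a_i|=0\}$, a field complete for the norm $\|\sum a_iT^i\|=\sup|a_i|$. $A^{\mathrm{an}}$ is the closure of $A$ in $H$ (a $K$-subalgebra). For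 $0\le\rho<1$, $\Gamma_\rho:=\{h=\sum h_iT^i\in H^* : \|h\|=|h_0|=1,\ |h_i|\le\rho^i\ \forall i>0\}$ (so for $\rho=0$, $h_i=0$ for all $i>0$), $\Gamma:=\bigcup_{0\le\rho<1}\Gamma_\rho$, and $\Gamma_A:=\Gamma/\big(((A^{\mathrm{an}})^*\cap\Gamma)\Gamma_0\big)$; $[h]$ denotes the class of $h\in\Gamma$. With $l(T):=\sum_{k\ge0}p^{-k}T^{p^k}$, set $h(T;\pi):=\exp(l(\pi T))$ for $\pi\in\mathcal{M}_K$ and $h_{\boldsymbol{\mu}}(T;\vec{\pi}):=\prod_{i=1}^gh(T^{\mu_i};\pi_i)\in\Gamma$. *)

(* Defs.v *)
From HB Require Import structures.
From mathcomp Require Import all_boot all_order all_algebra all_field.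
From mathcomp Require Import all_classical all_reals all_analysis.

Set Implicit Arguments.
Unset Strict Implicit.
Unset Printing Implicit Defensive.

Import Order.TTheory GRing.Theory Num.Theory.
Import numFieldNormedType.Exports.

Local Open Scope classical_set_scope.
Local Open Scope ring_scope.

Section AbsoluteValue.
Variables (R : realType) (F : fieldType) (v : F -> R).

Record is_ultrametric_abs : Prop := IsUltrametricAbs {
  abs_ge0 : forall x, 0 <= v x;
  abs_eq0 : forall x, v x = 0 <-> x = 0;
  absM : forall x y, v (x * y) = v x * v y;
  absD_max : forall x y, v (x + y) <= Num.max (v x) (v y)
}.

Definition abs_cvg (u : nat -> F) (l : F) : Prop :=
  (fun n => v (u n - l)) @ \oo --> (0 : R).

(* The junk value 0 is returned when u diverges. *)
Definition abs_lim (u : nat -> F) : F := xget 0 [set l | abs_cvg u l].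

Definition abs_cauchy (u : nat -> F) : Prop :=
  forall e : R, 0 < e ->
    exists N, forall m n, (N <= m)%N -> (N <= n)%N -> v (u m - u n) < e.

Definition abs_complete : Prop :=
  forall u, abs_cauchy u -> exists l, abs_cvg u l.

End AbsoluteValue.

Definition padic_abs (R : realType) (p : nat) (q : rat) : R :=
  if q == 0 then 0
  else p%:R ^+ logn p `|denq q|%N / p%:R ^+ logn p `|numq q|%N.

(* (Qp, v) is the field of p-adic numbers: the completion of rat for the p-adic
   absolute value, a notion that determines it up to a unique isometric
   isomorphism. *)
Record is_padic_field (R : realType) (p : nat) (Qp : fieldType) (v : Qp -> R) :
    Prop := IsPadicField {
  padic_is_abs : is_ultrametric_abs v;
  padic_ratr : forall q : rat, v (ratr q) = padic_abs R p q;
  padic_complete : abs_complete v;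
  padic_dense : forall (x : Qp) (e : R), 0 < e -> exists q : rat, v (x - ratr q) < e
}.

(* A series sum_i (f i) T^i is its family of coefficients f : int -> K.  This
   single carrier contains K((1/T)), K[[T]] and H, and [smul] below is the
   product of each of them. *)
Section Series.
Variables (R : realType) (K : fieldType) (v : K -> R).

Implicit Types (f h : int -> K) (S V W A : set (int -> K)).

Definition sconst (c : K) : int -> K := fun n => if n == 0 then c else 0.
Definition sone : int -> K := sconst 1.
Definition sscale (c : K) f : int -> K := fun n => c * f n.

(* Cauchy product: the n-th coefficient is the sum over all i in int of
   f i * h (n - i).  It converges in H when K is complete; in K((1/T)) and in
   K[[T]] only finitely many terms are nonzero, so that the partial sums are
   eventually constant and the limit is the formal product. *)
Definition smul f h : int -> K := fun n =>
  abs_lim v (fun N =>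
    \sum_(k < N) (f k%:Z * h (n - k%:Z) + f (- k.+1%:Z) * h (n + k.+1%:Z))).

Definition spow f (k : nat) : int -> K := iter k (smul f) sone.

(* The formal exponential of f in T K[[T]]: the n-th coefficient of f^k then
   vanishes for k > n, hence the partial sums are eventually constant. *)
Definition sexp f : int -> K := fun n =>
  abs_lim v (fun N => \sum_(k < N) (k`!%:R^-1 * spow f k n)).

Definition units S : set (int -> K) :=
  [set f | S f /\ exists2 h, S h & smul f h = sone].

Definition laurent : set (int -> K) :=
  [set f | exists N : int, forall n, N < n -> f n = 0].
Definition laurent_int : set (int -> K) :=
  [set f | forall n : int, 0 < n -> f n = 0].

Definition has_degree f (n : int) : Prop :=
  f n != 0 /\ forall m, n < m -> f m = 0.

Record is_subalgebra A : Prop := IsSubalgebra {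
  subalg_laurent : A `<=` laurent;
  subalg_one : A sone;
  subalg_lin : forall (c : K) f h, A f -> A h -> A (sscale c f + h);
  subalg_mul : forall f h, A f -> A h -> A (smul f h)
}.

(* dim_K V / (W `&` V) = g, through a family of V whose classes form a basis. *)
Definition quotient_dim V W (g : nat) : Prop :=
  exists e : 'I_g -> int -> K,
    (forall i, V (e i)) /\
    forall f, V f ->
      exists! c : 'I_g -> K, W (f - \sum_(i < g) sscale (c i) (e i)).

Definition degrees A : set int := [set n | exists2 f, A f & has_degree f n].

Definition is_gap_sequence A (g : nat) (mu : g.-tuple nat) : Prop :=
  sorted ltn mu /\ forall n : nat, n \in mu <-> ~ degrees A n%:Z.

Definition is_basis A (w : nat -> int -> K) : Prop :=
  [/\ forall i, A (w i),
      forall f, A f ->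
        exists (N : nat) (c : nat -> K), f = \sum_(i < N) sscale (c i) (w i) &
      forall (N : nat) (c : nat -> K), \sum_(i < N) sscale (c i) (w i) = 0 ->
        forall i, (i < N)%N -> c i = 0].

(* Indices start at 0: (s i, w i) is (s_{i+1}, v_{i+1}) in the usual numbering.
   The degree set is infinite (cofinite in nat) when A has finitely many gaps. *)
Definition is_standard_basis A (s : nat -> nat) (w : nat -> int -> K) : Prop :=
  [/\ {homo s : i j / (i < j)%N},
      degrees A = range (fun i => (s i)%:Z),
      is_basis A w,
      forall i, has_degree (w i) (s i)%:Z /\ w i (s i)%:Z = 1 &
      forall i j, (j < i)%N -> w i (s j)%:Z = 0].

Definition strictly_integral A : Prop :=
  exists s w, is_standard_basis A s w /\ forall i (j : int), v (w i j) <= 1.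

Definition Hfield : set (int -> K) :=
  [set f | (exists M : R, forall i, v (f i) <= M) /\
           (fun n : nat => v (f n%:Z)) @ \oo --> (0 : R)].

Definition snorm f : R := sup (range (v \o f)).

Definition analytic_closure A : set (int -> K) :=
  [set f | Hfield f /\
     forall e : R, 0 < e -> exists2 a, (A `&` Hfield) a & snorm (f - a) < e].

Definition Gamma_rho (rho : R) : set (int -> K) :=
  [set h | [/\ units Hfield h, snorm h = 1, v (h 0) = 1 &
               forall i : nat, (0 < i)%N -> v (h i%:Z) <= rho ^+ i]].

Definition Gamma : set (int -> K) :=
  \bigcup_(rho in [set rho : R | 0 <= rho < 1]) Gamma_rho rho.

Definition Gamma_sub A : set (int -> K) :=
  [set smul a b | a in units (analytic_closure A) `&` Gamma & b in Gamma_rho 0].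

(* The class [h] is the coset of h modulo Gamma_sub A. *)
Definition Gamma_class A h : set (int -> K) := [set smul h u | u in Gamma_sub A].

Definition Gamma_quot A : set (set (int -> K)) := Gamma_class A @` Gamma.

(* p^k = m forces k <= m, whence the bound on k. *)
Definition l_series (p : nat) : int -> K := fun n =>
  if n is Posz m then \sum_(k < m.+1 | (p ^ k == m)%N) p%:R ^- k else 0.

(* f(c T), for f in K[[T]] *)
Definition sdilate (c : K) f : int -> K := fun n => f n * c ^ n.

(* f(T^m), for m > 0 *)
Definition ssubst_pow (m : nat) f : int -> K := fun n =>
  if (m%:Z %| n)%Z then f (n %/ m%:Z)%Z else 0.

Definition h_series (p : nat) (pi : K) : int -> K :=
  sexp (sdilate pi (l_series p)).

Definition h_mu (p g : nat) (mu : g.-tuple nat) (pi : 'I_g -> K) : int -> K :=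
  \big[smul/sone]_(i < g) ssubst_pow (tnth mu i) (h_series p (pi i)).

Definition max_ideal_pow (g : nat) : set ('I_g -> K) :=
  [set pi | forall i, v (pi i) < 1].

End Series.

Arguments sconst {K} c.
Arguments laurent {K}.
Arguments max_ideal_pow {R K} v g.
Arguments laurent_int {K}.

(* Main.v *)
(** The exponential [E = exp(l)] of [l = sum_k X^(p^k) / p^k] satisfies
    [E(X)^p = E(X^p) exp(pX)], so that its coefficients are [p]-integral by
    Dwork's argument and [h(T; pi) = E(pi T)] has [n]-th coefficient bounded by
    [|pi|^n].  Suppose that [h_mu(pi) = h_mu(pi') a b] with [a] a unit of the
    closure of [A] and [b] in [Gamma_0], and put [delta = max |pi_i - pi'_i|].
    Then [h_mu(pi) - h_mu(pi') = sum_i (pi_i - pi'_i) T^mu_i + O(delta r)] with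
    [r < 1]: the largest coefficient has absolute value [delta], and the
    coefficients outside the gaps are strictly smaller.  On the other hand,
    multiplication by [h_mu(pi') = 1 + O(r)] and by [b] does not affect where the
    coefficients of [a] of positive degree are largest for the last time, and by
    strict integrality this degree [nu] is not a gap.  Hence [delta = 0]. *)

Require Import Defs.
From mathcomp Require Import all_boot all_order all_algebra all_field.
From mathcomp Require Import all_classical all_reals all_analysis.
From mathcomp Require Import ring lra zify.

Set Implicit Arguments.
Unset Strict Implicit.
Unset Printing Implicit Defensive.

Import Order.TTheory GRing.Theory Num.Theory.
Import numFieldNormedType.Exports.

Local Open Scope classical_set_scope.
Local Open Scope ring_scope.

(** * Ultrametric absolute values *)

(** The error is [O(delta r)] because [E] has linear coefficient [1] and [x^n - y^n] with [n >= 2]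
    is [x - y] times a form of positive degree in elements of absolute value at most [r]; in a
    product of one-units the mixed terms gain the same factor. The degree [nu] cannot be a gap
    because the coordinates of an element of [A] in the standard basis are its own coefficients at
    the degrees [s_i]: at a gap, its coefficient is an integral combination of those at larger
    [s_i], and the resulting bound passes to the closure. Two obstacles shape the rest. Dwork's
    argument uses the congruence of [x^p] and [x] modulo [p], which can fail for integral elements
    of [K], so that the coefficients of [E] must be known to be rational. And [a] is merely bounded
    in degrees [<= 0], so that the vanishing of [a b - 1] there has to be drawn from the equation
    between the two series. *)

Lemma cvg_to0P (R : realType) (u : nat -> R) : (forall n, 0 <= u n) ->
  (u @ \oo --> (0 : R)) <->
  (forall e, 0 < e -> exists N, forall n, (N <= n)%N -> u n < e).
Proof.
move=> u0; split.
  move/cvgrPdist_lt => cu e e0; have [N _ HN] := cu e e0.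
  exists N => n Nn; have := HN n Nn.
  by rewrite /= sub0r normrN ger0_norm.
move=> cu; apply/cvgrPdist_lt => e e0; have [N HN] := cu e e0.
by exists N => // n Nn /=; rewrite sub0r normrN ger0_norm // HN.
Qed.

Section UltrametricAbs.
Variables (R : realType) (F : fieldType) (v : F -> R).
Hypothesis v_abs : is_ultrametric_abs v.

Lemma vge0 x : 0 <= v x. Proof. exact: (abs_ge0 v_abs). Qed.
Hint Resolve vge0 : core.

Lemma v0 : v 0 = 0. Proof. exact/(abs_eq0 v_abs). Qed.

Lemma vM x y : v (x * y) = v x * v y. Proof. exact: (absM v_abs). Qed.

Lemma v_eq0 x : (v x == 0) = (x == 0).
Proof. by apply/eqP/eqP => /(abs_eq0 v_abs). Qed.

Lemma v_gt0 x : (0 < v x) = (x != 0).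
Proof. by rewrite lt0r v_eq0 vge0 andbT. Qed.

Lemma v1 : v 1 = 1.
Proof.
have v1n0 : v 1 != 0 by rewrite v_eq0 oner_eq0.
by apply: (mulfI v1n0); rewrite -vM !mulr1.
Qed.

Lemma vN x : v (- x) = v x.
Proof.
have vN1 : v (-1) = 1.
  have : (v (-1) - 1) * (v (-1) + 1) = 0.
    by rewrite -subr_sqr expr2 -vM mulrNN mulr1 v1 expr1n subrr.
  move/eqP; rewrite mulf_eq0 subr_eq0 => /orP[/eqP //|/eqP e].
  by have := vge0 (-1); lra.
by rewrite -mulN1r vM vN1 mul1r.
Qed.

Lemma vBC x y : v (x - y) = v (y - x).
Proof. by rewrite -vN opprB. Qed.

Lemma vX x n : v (x ^+ n) = v x ^+ n.
Proof. by elim: n => [|n IH]; rewrite ?expr0 ?v1 // !exprS vM IH. Qed.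

Lemma vV x : v x^-1 = (v x)^-1.
Proof.
have [->|xn0] := eqVneq x 0; first by rewrite invr0 v0 invr0.
have vxn0 : v x != 0 by rewrite v_eq0.
by apply: (mulfI vxn0); rewrite -vM !divff // v1.
Qed.

Lemma vD_le x y c : v x <= c -> v y <= c -> v (x + y) <= c.
Proof.
move=> xc yc; apply: le_trans (absD_max v_abs x y) _.
by rewrite ge_max xc yc.
Qed.

Lemma vB_le x y c : v x <= c -> v y <= c -> v (x - y) <= c.
Proof. by move=> xc yc; apply: vD_le; rewrite ?vN. Qed.

Lemma vD_lt x y c : v x < c -> v y < c -> v (x + y) < c.
Proof.
move=> xc yc; apply: le_lt_trans (absD_max v_abs x y) _.
by rewrite gt_max xc yc.
Qed.

Lemma vB_lt x y c : v x < c -> v y < c -> v (x - y) < c.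
Proof. by move=> xc yc; apply: vD_lt; rewrite ?vN. Qed.

Lemma v_sum_le I (s : seq I) (P : pred I) (f : I -> F) c : 0 <= c ->
  (forall i, P i -> v (f i) <= c) -> v (\sum_(i <- s | P i) f i) <= c.
Proof.
move=> c0 fc; apply: (big_ind (fun x => v x <= c)) => //; first by rewrite v0.
by move=> x y; apply: vD_le.
Qed.

Lemma v_dominant x y : v (x - y) < v y -> v x = v y.
Proof.
move=> xy; apply/eqP; rewrite eq_le; apply/andP; split.
  by rewrite -[x](subrK y) vD_le // ltW.
rewrite leNgt; apply/negP => yx.
have : v (x - (x - y)) < v y by apply: vB_lt.
by rewrite opprB addrC subrK ltxx.
Qed.

Lemma v_nat_le1 n : v n%:R <= 1.
Proof.
elim: n => [|n IH]; first by rewrite v0 ler01.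
by rewrite -natr1 vD_le // v1.
Qed.

Lemma v_int_le1 (n : int) : v n%:~R <= 1.
Proof. by case: n => n; rewrite ?NegzE ?mulrNz ?vN; exact: v_nat_le1. Qed.

Lemma abs_cvgP (u : nat -> F) l : abs_cvg v u l <->
  forall e, 0 < e -> exists N, forall n, (N <= n)%N -> v (u n - l) < e.
Proof. exact: cvg_to0P. Qed.

Lemma abs_cvg_unique (u : nat -> F) l l' :
  abs_cvg v u l -> abs_cvg v u l' -> l = l'.
Proof.
move=> /abs_cvgP ul /abs_cvgP ul'; apply/eqP; rewrite -subr_eq0 -v_eq0.
rewrite eq_le vge0 andbT; apply/ler_addgt0Pl => e e0; rewrite addr0.
have [N HN] := ul e e0; have [N' HN'] := ul' e e0.
have -> : l - l' = (u (maxn N N') - l') - (u (maxn N N') - l) by ring.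
by apply/ltW/vB_lt; [apply: HN'; exact: leq_maxr|apply: HN; exact: leq_maxl].
Qed.

Lemma abs_lim_eq (u : nat -> F) l : abs_cvg v u l -> abs_lim v u = l.
Proof.
by move=> ul; apply: xget_unique => // l' ul'; apply: abs_cvg_unique ul' ul.
Qed.

Lemma abs_cvg_eventually (u : nat -> F) l N :
  (forall n, (N <= n)%N -> u n = l) -> abs_cvg v u l.
Proof.
move=> ul; apply/abs_cvgP => e e0; exists N => n Nn.
by rewrite ul // subrr v0.
Qed.

Lemma abs_lim_eventually (u : nat -> F) l N :
  (forall n, (N <= n)%N -> u n = l) -> abs_lim v u = l.
Proof. by move=> ul; exact/abs_lim_eq/(abs_cvg_eventually ul). Qed.

Lemma abs_cvg_le (u : nat -> F) l x c : 0 <= c ->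
  abs_cvg v u l -> (exists N, forall n, (N <= n)%N -> v (u n - x) <= c) ->
  v (l - x) <= c.
Proof.
move=> c0 /abs_cvgP ul [N uc]; apply/ler_addgt0Pr => e e0.
have [N' HN'] := ul e e0.
have -> : l - x = (u (maxn N N') - x) - (u (maxn N N') - l) by ring.
apply: vB_le.
  by rewrite (le_trans (uc _ (leq_maxl _ _))) // lerDl ltW.
by rewrite (le_trans (ltW (HN' _ (leq_maxr _ _)))) // lerDr.
Qed.

(** A block of terms is bounded by its largest one, so that terms tending to zero suffice. *)
Lemma abs_cauchy_series (t : nat -> F) :
  (forall e, 0 < e -> exists N, forall n, (N <= n)%N -> v (t n) < e) ->
  abs_cauchy v (fun N => \sum_(k < N) t k).
Proof.
move=> t0 e e0; have [N HN] := t0 (e / 2) ltac:(lra).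
suff le_case m n : (N <= m)%N -> (m <= n)%N ->
    v (\sum_(k < n) t k - \sum_(k < m) t k) < e.
  exists N => m n Nm Nn; have [mn|/ltnW nm] := leqP m n.
    by rewrite vBC le_case.
  by rewrite le_case.
move=> Nm mn; rewrite -!(big_mkord xpredT t) (big_cat_nat (leq0n m) mn) /=.
rewrite addrAC subrr add0r big_nat; apply: (@le_lt_trans _ _ (e / 2)); last by lra.
apply: v_sum_le; first by lra.
by move=> i /andP[mi _]; apply/ltW/HN/(leq_trans Nm).
Qed.

End UltrametricAbs.

(** * Completeness of finite extensions *)

Section FiniteExtensionComplete.
Variables (R : realType) (k : fieldType) (vk : k -> R).
Hypotheses (vk_abs : is_ultrametric_abs vk) (vk_complete : abs_complete vk).
Variables (K : fieldExtType k) (v : K -> R).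
Hypotheses (v_abs : is_ultrametric_abs v) (v_ext : forall x, v x%:A = vk x).

(** Stated for subspaces, so that an induction can adjoin one vector at a time up to the whole of
    [K]. *)
Definition complete_subspace (U : {vspace K}) : Prop :=
  forall u : nat -> K, (forall n, u n \in U) -> abs_cauchy v u ->
  exists2 l, l \in U & abs_cvg v u l.

Lemma vZ (c : k) x : v (c *: x) = vk c * v x.
Proof. by rewrite -mulr_algl (vM v_abs) v_ext. Qed.

(** A complete subspace is closed: points of [W] within [1/(n+1)] of [x] would converge to [x] and
    put it in [W]. *)
Lemma dist_subspace_gt0 (W : {vspace K}) x : complete_subspace W -> x \notin W ->
  exists2 d, 0 < d & forall w, w \in W -> d <= v (x - w).
Proof.
move=> W_complete xW; apply: contrapT => no_d.
have /choice[w wP] : forall n, exists w, w \in W /\ v (x - w) < n.+1%:R^-1.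
  move=> n; apply: contrapT => no_w; apply: no_d; exists n.+1%:R^-1.
    by rewrite invr_gt0 ltr0n.
  by move=> w wW; rewrite leNgt; apply/negP => lt_w; apply: no_w; exists w.
have w_cvg : abs_cvg v w x.
  apply/(abs_cvgP v_abs) => e e0.
  have [N HN] : exists N : nat, e^-1 < N%:R.
    by exists (Num.truncn e^-1).+1; exact: truncnS_gt.
  exists N => n Nn; rewrite (vBC v_abs); apply: lt_trans (wP n).2 _.
  rewrite -[ltRHS]invrK ltf_pV2 ?posrE ?ltr0n ?invr_gt0 //.
  by apply: lt_le_trans HN _; rewrite ler_nat ltnW.
have [l lW w_l] : exists2 l, l \in W & abs_cvg v w l.
  apply: W_complete => [n|e e0]; first by have [] := wP n.
  have /(abs_cvgP v_abs) /(_ e e0)[N HN] := w_cvg.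
  exists N => m n Nm Nn; have -> : w m - w n = (w m - x) - (w n - x) by ring.
  by apply: (vB_lt v_abs); apply: HN.
by move: xW; rewrite (abs_cvg_unique v_abs w_cvg w_l) lW.
Qed.

(** With [d] the distance from [x] to [W], the vector [c x + w] has absolute value at least [|c| d].
    Hence the coordinates along [x] of a Cauchy sequence are Cauchy in the base field, and the
    remaining part is Cauchy in [W]. *)
Lemma complete_subspaceD (W : {vspace K}) x :
  complete_subspace W -> complete_subspace (<[x]> + W).
Proof.
move=> W_complete; have [xW|xW] := boolP (x \in W).
  by have /addv_idPr -> : (<[x]> <= W)%VS by [].
move=> u uU u_cauchy.
have /choice[c cP] : forall n, exists c, u n - c *: x \in W.
  move=> n; have /memv_addP[_ /vlineP[c ->] [w wW ->]] := uU n.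
  by exists c; rewrite addrC addKr.
have [d d0 dP] := dist_subspace_gt0 W_complete xW.
have c_le m n : vk (c m - c n) * d <= v (u m - u n).
  have [->|cn0] := eqVneq (c m - c n) 0.
    by rewrite (v0 vk_abs) mul0r (vge0 v_abs).
  set w := (u m - c m *: x) - (u n - c n *: x).
  have wW : w \in W by apply: rpredB.
  have -> : u m - u n = (c m - c n) *: (x - - ((c m - c n)^-1 *: w)).
    by rewrite opprK scalerDr scalerA divff // scale1r /w scalerBl; ring.
  by rewrite vZ ler_wpM2l ?(vge0 vk_abs) // dP // rpredN rpredZ.
have c_cauchy : abs_cauchy vk c.
  move=> e e0; have [N HN] := u_cauchy (e * d) (mulr_gt0 e0 d0).
  exists N => m n Nm Nn; rewrite -(ltr_pM2r d0).
  by apply: le_lt_trans (c_le m n) (HN m n Nm Nn).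
have [l c_l] := vk_complete c_cauchy.
have cx_l : abs_cvg v (fun n => c n *: x) (l *: x).
  apply/(abs_cvgP v_abs) => e e0.
  have vx1 : 0 < v x + 1 by have := vge0 v_abs x; lra.
  have /(abs_cvgP vk_abs) /(_ (e / (v x + 1)) (divr_gt0 e0 vx1))[N HN] := c_l.
  exists N => n Nn; rewrite -scalerBl vZ.
  apply: (@le_lt_trans _ _ (vk (c n - l) * (v x + 1))).
    by rewrite ler_wpM2l ?(vge0 vk_abs) // lerDl ler01.
  by rewrite -ltr_pdivlMr // HN.
have [w wW w_cvg] : exists2 w, w \in W & abs_cvg v (fun n => u n - c n *: x) w.
  apply: W_complete => // e e0; have [N HN] := u_cauchy e e0.
  have /(abs_cvgP v_abs) /(_ e e0)[N' HN'] := cx_l.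
  exists (maxn N N') => m n; rewrite !geq_max => /andP[Nm N'm] /andP[Nn N'n].
  have -> : u m - c m *: x - (u n - c n *: x) =
    (u m - u n) - ((c m *: x - l *: x) - (c n *: x - l *: x)) by ring.
  by apply: (vB_lt v_abs); [exact: HN|apply: (vB_lt v_abs); exact: HN'].
exists (l *: x + w); first by rewrite memv_add // memvZ // memv_line.
apply/(abs_cvgP v_abs) => e e0.
have /(abs_cvgP v_abs) /(_ e e0)[N HN] := w_cvg.
have /(abs_cvgP v_abs) /(_ e e0)[N' HN'] := cx_l.
exists (maxn N N') => n; rewrite geq_max => /andP[Nn N'n].
have -> : u n - (l *: x + w) = (c n *: x - l *: x) + (u n - c n *: x - w) by ring.
by apply: (vD_lt v_abs); [exact: HN'|exact: HN].
Qed.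

Lemma finite_ext_complete : abs_complete v.
Proof.
suff span_complete X : complete_subspace <<X>>.
  move=> u u_cauchy; have [|l _ ul] := span_complete (vbasis fullv) u _ u_cauchy.
    by move=> n; rewrite (span_basis (vbasisP fullv)) memvf.
  by exists l.
elim: X => [|x X IH]; last by rewrite span_cons; exact: complete_subspaceD.
move=> u u0 _; exists 0; first exact: mem0v.
apply: (@abs_cvg_eventually _ _ _ v_abs _ _ 0) => n _.
by apply/eqP; rewrite -memv0 -span_nil.
Qed.

End FiniteExtensionComplete.

(** * Integrality of the Artin-Hasse exponential *)

Section PolyTruncation.
Variable K : fieldType.
Implicit Types A B C D : {poly K}.

(** Congruence modulo [X^(n+1)]: power series are handled through truncations, for which the ring
    structure, derivation and composition of [{poly K}] are available. *)
Definition poly_eqm (n : nat) A B := forall i, (i <= n)%N -> A`_i = B`_i.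

Lemma poly_eqm_mul n A B C D :
  poly_eqm n A B -> poly_eqm n C D -> poly_eqm n (A * C) (B * D).
Proof.
move=> AB CD i le_in; rewrite !coefM; apply: eq_bigr => j _.
by rewrite AB ?CD //; [exact: leq_trans (leq_subr _ _) le_in|exact: leq_trans (leq_ord j) le_in].
Qed.

Lemma poly_eqm_comp_Xn n m A B : (0 < m)%N ->
  poly_eqm n A B -> poly_eqm n (A \Po 'X^m) (B \Po 'X^m).
Proof.
move=> m0 AB i le_in; rewrite !coef_comp_poly_Xn //; case: ifP => // _.
by rewrite AB //; apply: leq_trans (leq_div _ _) le_in.
Qed.

Lemma coef_Xderiv A i : ('X * A^`())`_i = i%:R * A`_i.
Proof.
rewrite coefXM; case: i => [|i]; first by rewrite mul0r.
by rewrite coef_deriv /= mulr_natl.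
Qed.

(** Since [W_0 = 0], the coefficient of [X^(i+1)] in [X Y' = W Y] expresses [(i+1) Y_(i+1)] through
    lower coefficients of [Y]. *)
Lemma log_deriv_uniq n (W Y Z : {poly K}) :
  (forall i, i.+1%:R != 0 :> K) -> W`_0 = 0 -> Y`_0 = Z`_0 ->
  poly_eqm n ('X * Y^`()) (W * Y) -> poly_eqm n ('X * Z^`()) (W * Z) ->
  poly_eqm n Y Z.
Proof.
move=> char0 W0 YZ0 DY DZ; elim/ltn_ind => [[|i] IH] le_in //.
apply: (mulfI (char0 i)); rewrite -!coef_Xderiv DY // DZ // !coefM.
rewrite [LHS]big_ord_recl [RHS]big_ord_recl W0 !mul0r !add0r; apply: eq_bigr => j _ /=.
by rewrite /bump add1n subSS IH // ?ltnS ?leq_subr // (leq_trans (leq_subr _ _)) // ltnW.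
Qed.

Lemma coef_exp_low (A : {poly K}) k i : A`_0 = 0 -> (i < k)%N -> (A ^+ k)`_i = 0.
Proof.
move=> A0; elim: k i => // k IH i; rewrite ltnS => le_ik.
rewrite exprS coefM big_ord_recl A0 mul0r add0r big1 // => j _.
rewrite lift0 IH ?mulr0 //; have := ltn_ord j; lia.
Qed.

End PolyTruncation.

(** * Coefficientwise bounds and the Frobenius congruence modulo [p] *)

Section PolyBound.
Variables (R : realType) (K : fieldType) (v : K -> R).
Hypothesis v_abs : is_ultrametric_abs v.
Implicit Types A B : {poly K}.

Definition coef_bound (c : R) A := forall i, v A`_i <= c.

Lemma coef_boundM c d A B : 0 <= c -> 0 <= d ->
  coef_bound c A -> coef_bound d B -> coef_bound (c * d) (A * B).
Proof.
move=> c0 d0 Ac Bd i; rewrite coefM; apply: (v_sum_le v_abs) => [|j _].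
  exact: mulr_ge0.
by rewrite (vM v_abs) ler_pM ?(vge0 v_abs).
Qed.

Lemma coef_boundX A n : coef_bound 1 A -> coef_bound 1 (A ^+ n).
Proof.
move=> A1; elim: n => [|n IH]; last by rewrite exprS -[1]mulr1; exact: coef_boundM.
by move=> i; rewrite expr0 coef1; case: eqP => _; rewrite ?(v0 v_abs) ?(v1 v_abs).
Qed.

Lemma coef_boundD c A B :
  coef_bound c A -> coef_bound c B -> coef_bound c (A + B).
Proof. by move=> Ac Bc i; rewrite coefD (vD_le v_abs). Qed.

Lemma v_natr_dvd d m : (d %| m)%N -> v m%:R <= v d%:R.
Proof.
case/dvdnP => q ->; rewrite natrM (vM v_abs).
by rewrite ler_piMl ?(vge0 v_abs) ?(v_nat_le1 v_abs).
Qed.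

(** The binomial coefficients ['C(p, i)] with [0 < i < p] are divisible by [p]. *)
Lemma frobenius_poly2 p A B : prime p -> coef_bound 1 A -> coef_bound 1 B ->
  coef_bound (v p%:R) ((A + B) ^+ p - (A ^+ p + B ^+ p)).
Proof.
move=> p_prime A1 B1; rewrite exprDn (bigD1 ord0) //= (bigD1 ord_max) /=; last first.
  by rewrite -val_eqE /= -lt0n prime_gt0.
rewrite subn0 subnn !expr0 bin0 binn !mulr1n mulr1 mul1r.
rewrite [A ^+ p + (_ + _)]addrA [X in X - _]addrC addrK.
apply: (big_ind (coef_bound (v p%:R))).
- by move=> i; rewrite coef0 (v0 v_abs) (vge0 v_abs).
- exact: coef_boundD.
move=> i /andP[i0 ip] j; rewrite coefMn -[_ *+ 'C(_, _)]mulr_natr (vM v_abs).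
rewrite -[leRHS]mul1r ler_pM ?(vge0 v_abs) //.
  by rewrite -[1]mulr1; apply: coef_boundM => //; exact: coef_boundX.
apply: v_natr_dvd; apply: prime_dvd_bin => //.
by rewrite lt0n i0 /= ltn_neqAle ip -ltnS ltn_ord.
Qed.

Lemma frobenius2 p x y : prime p -> v x <= 1 -> v y <= 1 ->
  v ((x + y) ^+ p - (x ^+ p + y ^+ p)) <= v p%:R.
Proof.
move=> p_prime x1 y1.
have C1 z : v z <= 1 -> coef_bound 1 z%:P.
  by move=> z1 i; rewrite coefC; case: ifP => // _; rewrite (v0 v_abs).
have := frobenius_poly2 p_prime (C1 _ x1) (C1 _ y1) 0%N.
by rewrite -polyCD -!polyC_exp -polyCD -polyCB coefC.
Qed.

Lemma frobenius_poly p n (e : nat -> K) : prime p ->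
  (forall i, (i < n)%N -> v (e i) <= 1) ->
  coef_bound (v p%:R)
    ((\sum_(i < n) e i *: 'X^i) ^+ p - \sum_(i < n) e i ^+ p *: 'X^(i * p)).
Proof.
move=> p_prime; elim: n => [|n IH] e1.
  rewrite !big_ord0 expr0n; have -> : (p == 0)%N = false by have := prime_gt0 p_prime; lia.
  by move=> i; rewrite subr0 coef0 (v0 v_abs) (vge0 v_abs).
rewrite !big_ord_recr /=; set P := \sum_(i < n) _; set Q := \sum_(i < n) _.
set T := _ *: 'X^n.
have -> : (P + T) ^+ p - (Q + e n ^+ p *: 'X^(n * p)) =
  ((P + T) ^+ p - (P ^+ p + T ^+ p)) + (P ^+ p - Q).
  by rewrite /T exprZn -exprM; ring.
apply: coef_boundD; last by apply: IH => i lt_in; apply: e1; exact: ltnW.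
apply: frobenius_poly2 => //.
  move=> j; rewrite coef_sum; apply: (v_sum_le v_abs) => // i _.
  rewrite coefZ coefXn; case: eqP => _; rewrite ?mulr0 ?(v0 v_abs) // mulr1.
  by apply: e1; apply: ltnW; rewrite ltnS.
move=> j; rewrite coefZ coefXn; case: eqP => _; rewrite ?mulr0 ?(v0 v_abs) // mulr1.
exact: e1.
Qed.

End PolyBound.

(** By Legendre's formula [logn p n!] is the sum of the iterated quotients of [n] by [p]. With
    [m' = m %/ p], those of [m] are [m'] and those of [m'], so that by induction their sum is [0] or
    less than [2 m' <= m]. *)
Lemma logn_fact_lt p n : prime p -> (0 < n)%N -> (logn p n`! < n)%N.
Proof.
move=> p_prime n0; rewrite logn_fact // big_add1 /=; have p2 := prime_gt1 p_prime.
suff sum_lt m k : (0 < m)%N -> (\sum_(0 <= i < k) m %/ p ^ i.+1 < m)%N.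
  exact: sum_lt.
elim: k m => [|k IH] m m0; first by rewrite big_nil.
rewrite big_nat_recl // expn1.
under eq_bigr do rewrite expnS divnMA.
have le_m : (m %/ p * 2 <= m)%N.
  by apply: leq_trans (leq_divM m p); rewrite leq_mul2l p2 orbT.
have [mp0|mp0] := posnP (m %/ p)%N.
  by rewrite mp0 big1 // => i _; rewrite div0n.
by have := IH _ mp0; lia.
Qed.

(** * Dwork's argument for the coefficients of [E] *)

Section ArtinHasse.
Variables (R : realType) (p : nat) (K : fieldType) (v : K -> R).
Hypotheses (p_prime : prime p) (v_abs : is_ultrametric_abs v).
Hypothesis v_ratr : forall q : rat, v (ratr q) = padic_abs R p q.

Lemma v_natr n : (0 < n)%N -> v n%:R = p%:R ^- logn p n.
Proof.
move=> n0; rewrite -[n%:R]ratr_nat v_ratr /padic_abs pnatr_eq0 eqn0Ngt n0 /=.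
have -> : n%:R = n%:Z%:~R :> rat by [].
by rewrite denq_int numq_int !absz_nat logn1 expr0 mul1r.
Qed.

Lemma natr_neq0 n : n.+1%:R != 0 :> K.
Proof.
rewrite -(v_eq0 v_abs) v_natr // invr_eq0 expf_neq0 // pnatr_eq0.
by have := prime_gt0 p_prime; lia.
Qed.

Lemma v_p : v p%:R = p%:R^-1.
Proof. by rewrite v_natr ?prime_gt0 // logn_prime // eqxx expr1. Qed.

Lemma v_p_gt0 : 0 < v p%:R.
Proof. by rewrite v_p invr_gt0 ltr0n prime_gt0. Qed.

Lemma v_p_lt1 : v p%:R < 1.
Proof. by rewrite v_p invf_lt1 ?ltr1n ?ltr0n ?prime_gt1 ?prime_gt0. Qed.

(** These are the coefficients of [exp(pX)]: as [n!] has fewer than [n] factors [p], at least one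
    factor of [p^n] survives. *)
Lemma v_exp_coef n : (0 < n)%N -> v (p%:R ^+ n / n`!%:R) <= v p%:R.
Proof.
move=> n0; rewrite (vM v_abs) (vX v_abs) (vV v_abs) (v_natr (fact_gt0 n)) -exprVn -v_p.
rewrite -exprVn.
have lt_n := logn_fact_lt p_prime n0.
rewrite -[in X in X * _](subnK (ltnW lt_n)) exprD -mulrA -exprMn divff ?expr1n ?mulr1; last first.
  by rewrite gt_eqF // v_p_gt0.
rewrite -[leRHS]expr1; apply: ler_wiXn2l; rewrite ?(vge0 v_abs) ?ltW ?v_p_lt1 //.
by rewrite subn_gt0.
Qed.

Lemma fermat_nat n : v (n%:R ^+ p - n%:R) <= v p%:R.
Proof.
have [->|n0] := posnP n.
  by rewrite expr0n gtn_eqF ?prime_gt0 // subr0 (v0 v_abs) (vge0 v_abs).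
have le_n : (n <= n ^ p)%N by rewrite -{1}[n]expn1 leq_pexp2l // prime_gt0.
rewrite -natrX -natrB //; apply: (v_natr_dvd v_abs).
by rewrite -eqn_mod_dvd // fermat_little.
Qed.

Lemma fermat_int (z : int) : v (z%:~R ^+ p - z%:~R) <= v p%:R.
Proof.
case: z => n; first exact: fermat_nat.
rewrite NegzE mulrNz; set x : K := _%:~R.
have x1 : v x <= 1 by exact: (v_int_le1 v_abs n.+1).
have := @frobenius2 _ _ _ v_abs p x (- x) p_prime x1.
rewrite (vN v_abs) => /(_ x1); rewrite subrr expr0n gtn_eqF ?prime_gt0 // sub0r => frob.
have -> : (- x) ^+ p - (- x) = - (- (x ^+ p + (- x) ^+ p)) - (x ^+ p - x) by ring.
by apply: (vB_le v_abs); [rewrite (vN v_abs)|exact: fermat_nat].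
Qed.

(** An integral rational has a denominator prime to [p], of absolute value [1]; once it is cleared,
    the claim reduces to Fermat for the numerator and the denominator. *)
Lemma fermat_rat q : v (ratr q) <= 1 -> v (ratr q ^+ p - ratr q) <= v p%:R.
Proof.
have [->|q0] := eqVneq q 0.
  by rewrite (ratr_nat K 0 : ratr 0 = 0) expr0n gtn_eqF ?prime_gt0 // subrr (v0 v_abs) (vge0 v_abs).
rewrite {1}v_ratr /padic_abs (negPf q0) => q1.
have pd : ~~ (p %| `|denq q|)%N.
  apply/negP => pd; have := coprime_num_den q; rewrite coprime_sym => cop.
  have pn : coprime p `|numq q| by apply: coprime_dvdl pd cop.
  move: q1; rewrite (logn_coprime pn) expr0 divr1 leNgt => /negP; apply.
  rewrite exprn_egt1 ?ltr1n ?prime_gt1 // -lt0n logn_gt0 mem_primes p_prime pd andbT.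
  by rewrite absz_gt0 denq_neq0.
have vd : v (denq q)%:~R = 1.
  rewrite -[denq q]gez0_abs ?denq_ge0 // v_natr ?absz_gt0 ?denq_neq0 //.
  by rewrite logn_coprime ?prime_coprime // expr0 invr1.
have d0 : (denq q)%:~R != 0 :> K by rewrite -(v_eq0 v_abs) vd oner_eq0.
have -> : ratr q = (numq q)%:~R / (denq q)%:~R :> K by [].
set a : K := (numq q)%:~R; set b : K := (denq q)%:~R in vd d0 *.
suff : v (b ^+ p.+1 * ((a / b) ^+ p - a / b)) <= v p%:R.
  by rewrite (vM v_abs) (vX v_abs) vd expr1n mul1r.
have -> : b ^+ p.+1 * ((a / b) ^+ p - a / b) = (a ^+ p - a) * b - (b ^+ p - b) * a.
  by rewrite expr_div_n exprS; field; rewrite d0 expf_neq0.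
by apply: (vB_le v_abs); rewrite (vM v_abs) -[leRHS]mulr1;
  rewrite ler_pM ?(vge0 v_abs) ?(v_int_le1 v_abs) // fermat_int.
Qed.

(** Its indicator gives the coefficients of [X l'(X) = sum_k X^(p^k)], the logarithmic derivative
    [X E'/E]. The bound on [k] loses nothing, as [k < p^k]. *)
Definition is_ppow (i : nat) : bool := [exists k : 'I_i.+1, (p ^ k == i)%N].

Lemma is_ppowP i : reflect (exists k, i = (p ^ k)%N) (is_ppow i).
Proof.
apply: (iffP existsP) => [[k /eqP <-]|[k ->]]; first by exists k.
have lt_k : (k < (p ^ k).+1)%N by rewrite ltnS ltnW // ltn_expl // prime_gt1.
by exists (Ordinal lt_k).
Qed.

Lemma is_ppow_rec i : is_ppow i = (i == 1%N) || (p %| i)%N && is_ppow (i %/ p).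
Proof.
have p0 := prime_gt0 p_prime.
apply/is_ppowP/idP => [[[|k] ->]|].
- by rewrite expn0.
- rewrite expnS dvdn_mulr // mulKn //=; apply/orP; right.
  by apply/is_ppowP; exists k.
case/orP => [/eqP ->|/andP[/dvdnP[m ->]]]; first by exists 0%N.
by rewrite mulnK // => /is_ppowP[k ->]; exists k.+1; rewrite expnSr.
Qed.

Lemma is_ppow0 : is_ppow 0 = false.
Proof.
apply/is_ppowP => -[k /eqP]; rewrite eq_sym expn_eq0.
by have := prime_gt0 p_prime; case: p.
Qed.

(** The hypotheses on [e] are [E(0) = 1] and [X E' = (sum_k X^(p^k)) E], read coefficient by
    coefficient. *)
Variable e : nat -> K.
Hypothesis e0 : e 0 = 1.
Hypothesis e_rec : forall n,
  n%:R * e n = \sum_(i < n.+1) (is_ppow i)%:R * e (n - i)%N.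

(** Explicit fractions are added and divided directly in [K]; the passage to [ratr] is made once, in
    [is_frac_ratr]. *)
Definition is_frac (x : K) := exists (a : int) (m : nat), x = a%:~R / m.+1%:R.

Lemma is_frac_int (a : int) : is_frac a%:~R.
Proof. by exists a, 0%N; rewrite divr1. Qed.

Lemma is_fracD x y : is_frac x -> is_frac y -> is_frac (x + y).
Proof.
move=> [a [m ->]] [b [n ->]]; exists (a * n.+1%:Z + b * m.+1%:Z), (m.+1 * n.+1).-1.
by rewrite prednK ?muln_gt0 // natrM rmorphD !rmorphM /=; field; rewrite !nat1r !natr_neq0.
Qed.

Lemma is_frac_divn x n : is_frac x -> is_frac (x / n.+1%:R).
Proof.
move=> [a [m ->]]; exists a, (m.+1 * n.+1).-1.
by rewrite prednK ?muln_gt0 // natrM; field; rewrite !nat1r !natr_neq0.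
Qed.

Lemma is_frac_ratr x : is_frac x -> exists q, x = ratr q.
Proof.
move=> [a [m ->]]; pose q : rat := a%:~R / m.+1%:R; exists q.
rewrite /ratr; have d0 : (denq q)%:~R != 0 :> K.
  by rewrite -[denq q]gez0_abs ?denq_ge0 // -(prednK (n := `|denq q|%N)) ?natr_neq0 // absz_gt0 denq_neq0.
have /intr_inj : (a * denq q)%:~R = (numq q * m.+1%:Z)%:~R :> rat.
  by rewrite !rmorphM /= numqE mulrAC divfK // pnatr_eq0.
move/(congr1 (fun z : int => z%:~R : K)); rewrite !rmorphM /= => eq_K.
apply/eqP; rewrite eqr_div ?natr_neq0 //; exact/eqP.
Qed.

Lemma artin_hasse_frac n : is_frac (e n).
Proof.
elim/ltn_ind: n => -[|n] IH; first by rewrite e0; exact: is_frac_int 1.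
have -> : e n.+1 = n.+1%:R * e n.+1 / n.+1%:R by rewrite mulrC mulKf ?natr_neq0.
apply: is_frac_divn; rewrite e_rec big_ord_recl is_ppow0 mul0r add0r.
apply: (big_ind is_frac); [exact: is_frac_int 0|exact: is_fracD|].
move=> i _; rewrite lift0 subSS.
case: is_ppow; rewrite ?mul0r ?mul1r; last exact: is_frac_int 0.
by apply: IH; rewrite ltnS leq_subr.
Qed.

(* That is, [E(X)^p = E(X^p) exp(pX)] with [E = exp(l)]; both sides have
   the logarithmic derivative [p sum_k X^(p^k)]. *)
Lemma artin_hasse_functional n :
  let E := \poly_(i < n.+1) e i in
  let G := \poly_(i < n.+1) (p%:R ^+ i / i`!%:R) in
  poly_eqm n (E ^+ p) ((E \Po 'X^p) * G).
Proof.
move=> E G; have p0 := prime_gt0 p_prime.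
pose S : {poly K} := \poly_(i < n.+1) (is_ppow i)%:R.
have coefE i : (i <= n)%N -> E`_i = e i by move=> le_in; rewrite coef_poly ltnS le_in.
have coefG i : (i <= n)%N -> G`_i = p%:R ^+ i / i`!%:R.
  by move=> le_in; rewrite coef_poly ltnS le_in.
have coefS i : (i <= n)%N -> S`_i = (is_ppow i)%:R.
  by move=> le_in; rewrite coef_poly ltnS le_in.
have DE : poly_eqm n ('X * E^`()) (S * E).
  move=> i le_in; rewrite coef_Xderiv coefE // e_rec coefM.
  apply: eq_bigr => j _; rewrite coefS ?coefE //.
    exact: leq_trans (leq_subr _ _) le_in.
  exact: leq_trans (leq_ord j) le_in.
have DG : poly_eqm n ('X * G^`()) (p%:R *: 'X * G).
  move=> [|i] le_in; rewrite coef_Xderiv -scalerAl coefZ coefXM; first by rewrite mul0r mulr0.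
  rewrite /= !coefG // ?(ltnW le_in) // factS natrM exprS.
  by field; rewrite nat1r natr_neq0 -(prednK (fact_gt0 i)) natr_neq0.
(* A power of [p] is [1] or [p] times a power of [p]. *)
have S_split : poly_eqm n S ((S \Po 'X^p) + 'X).
  move=> i le_in; rewrite coefD coef_comp_poly_Xn // coefX coefS // is_ppow_rec.
  case: eqP => [->|_] /=.
    by rewrite gtnNdvd ?prime_gt1 // add0r.
  rewrite addr0; case: ifP => // _; rewrite coefS //.
  exact: leq_trans (leq_div _ _) le_in.
apply: (@log_deriv_uniq _ _ (p%:R *: S)) => //.
- exact: natr_neq0.
- by rewrite coefZ coefS // is_ppow0 mulr0.
- rewrite coef0M coef_comp_poly_Xn // dvdn0 div0n coefE // e0 mul1r coefG //.
  by rewrite expr0 fact0 divr1 -horner_coef0 horner_exp horner_coef0 coefE // e0 expr1n.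
- have -> : 'X * (E ^+ p)^`() = (p%:R *: E ^+ p.-1) * ('X * E^`()).
    by rewrite deriv_exp scaler_nat; ring.
  have -> : p%:R *: S * E ^+ p = (p%:R *: E ^+ p.-1) * (S * E).
    have -> : E ^+ p = E * E ^+ p.-1 by rewrite -exprS prednK.
    by rewrite !scaler_nat; ring.
  exact: poly_eqm_mul.
(* The chain rule for [E(X^p)] produces [p X^(p-1)], which the outer [X] completes to [p X^p]:
   whence [p] times [X E'] evaluated at [X^p]. *)
have -> : 'X * ((E \Po 'X^p) * G)^`() =
    (p%:R *: G) * (('X * E^`()) \Po 'X^p) + (E \Po 'X^p) * ('X * G^`()).
  rewrite derivM deriv_comp derivXn comp_polyM comp_polyX !scaler_nat.
  have -> : 'X^p = 'X * 'X ^+ p.-1 :> {poly K} by rewrite -exprS prednK.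
  have alg (x y a b c d : {poly K}) m :
    x * (a * (y *+ m) * c + b * d) = c *+ m * (x * y * a) + b * (x * d) by ring.
  exact: alg.
move=> i le_in; rewrite coefD.
have DE_comp : poly_eqm n (p%:R *: G * (('X * E^`()) \Po 'X^p))
    (p%:R *: G * ((S * E) \Po 'X^p)).
  by apply: poly_eqm_mul => //; exact: poly_eqm_comp_Xn.
have DG_mul : poly_eqm n ((E \Po 'X^p) * ('X * G^`()))
    ((E \Po 'X^p) * (p%:R *: 'X * G)) by exact: poly_eqm_mul.
rewrite DE_comp // DG_mul // -coefD.
have -> : p%:R *: G * ((S * E) \Po 'X^p) + (E \Po 'X^p) * (p%:R *: 'X * G) =
  ((S \Po 'X^p) + 'X) * (p%:R *: ((E \Po 'X^p) * G)).
  have alg (x a b c s : {poly K}) m :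
    c *+ m * (s * a) + a * (x *+ m * c) = (s + x) * ((a * c) *+ m) by ring.
  by rewrite comp_polyM !scaler_nat; exact: alg.
rewrite -scalerAl -scalerAr coefZ [in RHS]coefZ; congr (_ * _).
by apply: (@poly_eqm_mul _ n) => // j le_jn; rewrite S_split.
Qed.

(* Compare the coefficients of [X^n] in the functional equation modulo [p]:
   the terms other than [p e_n] cancel by Frobenius and Fermat. *)
Lemma artin_hasse_integral n : v (e n) <= 1.
Proof.
elim/ltn_ind: n => -[|n] IH; first by rewrite e0 (v1 v_abs).
have p0 := prime_gt0 p_prime; set N := n.+1 in IH *.
have := @artin_hasse_functional N N (leqnn _); set E := \poly_(i < _) _; set G := \poly_(i < _) _.
(* [P] omits the term of degree [N], whose integrality is at stake, so that the induction hypothesis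
   covers it. [Q] is [P] with coefficients raised to the power [p] and [X] replaced by [X^p]; it is
   congruent to [P^p]. *)
pose P : {poly K} := \sum_(i < N) e i *: 'X^i.
pose Q : {poly K} := \sum_(i < N) e i ^+ p *: 'X^(i * p).
have EP : E = P + e N *: 'X^N by rewrite /E poly_def big_ord_recr.
have E0 : E.[0] = 1 by rewrite horner_coef0 coef_poly e0.
have P0 : P.[0] = 1 by rewrite -E0 EP hornerD hornerZ hornerXn expr0n mulr0 addr0.
(* In [E^p - P^p = e_N X^N sum_i E^(p-1-i) P^i] the constant terms [E(0) = P(0) = 1] leave [p e_N]
   in degree [N]. *)
have -> : (E ^+ p)`_N = (P ^+ p)`_N + p%:R * e N.
  have -> : E ^+ p = P ^+ p + (E ^+ p - P ^+ p) by rewrite addrC subrK.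
  rewrite subrXX {1}EP addrAC subrr add0r coefD; congr (_ + _).
  rewrite -scalerAl coefZ coefXnM ltnn subnn -horner_coef0 horner_sum.
  rewrite (eq_bigr (fun=> 1)) => [|i _]; last first.
    by rewrite hornerM !horner_exp E0 P0 !expr1n mulr1.
  by rewrite sumr_const card_ord mulrC.
rewrite coefM big_ord_recr /= subnn [G`_0]coef_poly /= fact0 expr0 divr1 mulr1.
(* The term with [G_0 = 1] is split off; [rest] contains only coefficients of [exp(pX)] of positive
   degree, all divisible by [p]. *)
set rest := \sum_(i < N) _ => eq_N.
have rest_p : v rest <= v p%:R.
  apply: (v_sum_le v_abs) => [|i _]; first exact: vge0.
  rewrite (vM v_abs) -[leRHS]mul1r ler_pM ?(vge0 v_abs) //.
    rewrite coef_comp_poly_Xn //; case: ifP => _; rewrite ?(v0 v_abs) // coef_poly.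
    case: ifP => _; rewrite ?(v0 v_abs) // IH //.
    exact: leq_ltn_trans (leq_div _ _) (ltn_ord i).
  rewrite coef_poly; case: ifP => _; last by rewrite (v0 v_abs) (vge0 v_abs).
  by rewrite v_exp_coef // subn_gt0.
have Q_p : v ((E \Po 'X^p)`_N - Q`_N) <= v p%:R.
  rewrite coef_comp_poly_Xn // /Q coef_sum; case: ifP => pN.
    have lt_N : (N %/ p < N)%N by rewrite ltn_Pdiv ?prime_gt1.
    rewrite (bigD1 (Ordinal lt_N)) //= coefZ coefXn divnK // eqxx mulr1.
    rewrite big1 => [|i ne_i]; last first.
      rewrite coefZ coefXn; case: eqP => [eq_i|_]; last by rewrite mulr0.
      by case/eqP: ne_i; apply/val_inj => /=; rewrite [in RHS]eq_i mulnK.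
    rewrite addr0 coef_poly ltnS ltnW // (vBC v_abs).
    (* What remains is the congruence of [e_m^p] and [e_m] modulo [p] for [m = N %/ p]; here
       rationality enters. *)
    have [q eq_q] := is_frac_ratr (artin_hasse_frac (N %/ p)).
    by rewrite eq_q fermat_rat // -eq_q IH.
  rewrite big1 => [|i _]; first by rewrite subr0 (v0 v_abs) (vge0 v_abs).
  rewrite coefZ coefXn; case: eqP => [eq_i|_]; last by rewrite mulr0.
  by move: pN; rewrite [X in (_ %| X)%N]eq_i dvdn_mull.
have PQ_p : v ((P ^+ p)`_N - Q`_N) <= v p%:R.
  by rewrite -coefB; exact: (frobenius_poly v_abs p_prime IH).
have : v (p%:R * e N) <= v p%:R.
  have -> : p%:R * e N = rest + ((E \Po 'X^p)`_N - Q`_N) - ((P ^+ p)`_N - Q`_N).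
    have alg (a b r c q : K) : a + b = r + c -> b = r + (c - q) - (a - q).
      by move=> ab; transitivity ((a + b) - a); [ring|rewrite ab; ring].
    exact: alg.
  by apply: (vB_le v_abs) => //; exact: (vD_le v_abs).
by rewrite (vM v_abs) ger_pMr // v_p_gt0.
Qed.

End ArtinHasse.

(** * Products and exponentials of series *)

Section SeriesProduct.
Variables (R : realType) (K : fieldType) (v : K -> R).
Hypothesis v_abs : is_ultrametric_abs v.
Implicit Types f g h : int -> K.

Definition nonneg_series f := forall n : int, n < 0 -> f n = 0.

Definition smul_term f h (n : int) (k : nat) : K :=
  f k%:Z * h (n - k%:Z) + f (- k.+1%:Z) * h (n + k.+1%:Z).

Lemma smul_coef f h (n : nat) : nonneg_series f -> nonneg_series h ->
  smul v f h n%:Z = \sum_(i < n.+1) f i%:Z * h (n - i)%N%:Z.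
Proof.
move=> f0 h0; apply: (@abs_lim_eventually _ _ _ v_abs _ _ n.+1) => M le_nM.
rewrite (big_ord_widen M (fun i => f i%:Z * h (n - i)%N%:Z)) // [RHS]big_mkcond.
apply: eq_bigr => k _ /=; rewrite (f0 (- k.+1%:Z)) // mul0r addr0 ltnS.
case: leqP => [le_kn|lt_nk]; first by rewrite subzn.
by rewrite h0 ?mulr0 //; lia.
Qed.

Lemma smul_nonneg f h :
  nonneg_series f -> nonneg_series h -> nonneg_series (smul v f h).
Proof.
move=> f0 h0 n n0; apply: (@abs_lim_eventually _ _ _ v_abs _ _ 0) => M _.
rewrite big1 // => k _; rewrite (f0 (- k.+1%:Z)) // mul0r addr0 h0 ?mulr0 //; lia.
Qed.

Lemma smul_coef0 f h : nonneg_series f -> nonneg_series h ->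
  smul v f h 0 = f 0 * h 0.
Proof. by move=> f0 h0; rewrite (@smul_coef f h 0) // big_ord1. Qed.

Lemma smul1s f : smul v (sone K) f = f.
Proof.
apply/funext => n; apply: (@abs_lim_eventually _ _ _ v_abs _ _ 1) => -[|M] // _.
rewrite big_ord_recl big1 => [|k _]; last first.
  by rewrite /sone /sconst lift0 /= !mul0r addr0.
by rewrite /sone /sconst /= mul1r mul0r !addr0.
Qed.

Lemma smuls1 f : smul v f (sone K) = f.
Proof.
apply/funext => n; rewrite /sone /sconst.
apply: (@abs_lim_eventually _ _ _ v_abs _ _ (`|n|%N).+1) => M lt_nM.
(* The index of the only nonzero term: [n] in the first summand if [n >= 0], and [|n| - 1] in the
   second if [n < 0], since the latter is indexed by [- k.+1]. *)
have lt_m : ((if n is Posz m then m else `|n|.-1) < M)%N.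
  by case: n lt_nM => m //=; lia.
rewrite (bigD1 (Ordinal lt_m)) //= big1 => [|k /eqP ne_k].
  case: n lt_nM lt_m => m lt_nM lt_m /=.
    rewrite subrr eqxx mulr1 addr0.
    by case: eqP => [|_]; [lia|rewrite mulr0 addr0].
  rewrite ifF; last by apply/eqP; lia.
  rewrite ifT; last by apply/eqP; lia.
  by rewrite mulr0 add0r mulr1 addr0; congr f; lia.
case: eqP => [eq_k|_].
  by case: ne_k; apply/val_inj => /=; case: n eq_k {lt_nM lt_m} => m /=; lia.
case: eqP => [eq_k|_]; last by rewrite !mulr0 addr0.
by case: ne_k; apply/val_inj => /=; case: n eq_k {lt_nM lt_m} => m /=; lia.
Qed.

(** For a complete ultrametric absolute value this is convergence of the product in degree [n]. *)
Definition smul_summable f h n :=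
  forall e, 0 < e -> exists N, forall k, (N <= k)%N -> v (smul_term f h n k) < e.

Hypothesis v_complete : abs_complete v.

Lemma smul_cvg f h n : smul_summable f h n ->
  abs_cvg v (fun N => \sum_(k < N) smul_term f h n k) (smul v f h n).
Proof.
move=> /(abs_cauchy_series v_abs) /v_complete[l cvg_l].
by rewrite [smul _ _ _ _](abs_lim_eq v_abs cvg_l).
Qed.

(** Serves to isolate the dominant term of a product, with an error bounded by the other terms. *)
Lemma smul_sub_le f h n k0 c : smul_summable f h n -> 0 <= c ->
  (forall k, k != k0 -> v (smul_term f h n k) <= c) ->
  v (smul v f h n - smul_term f h n k0) <= c.
Proof.
move=> sum_fh c0 le_c; apply: (abs_cvg_le v_abs c0 (smul_cvg sum_fh)).
exists k0.+1 => N lt_k0N; rewrite (bigD1 (Ordinal lt_k0N)) //= addrAC subrr add0r.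
apply: (v_sum_le v_abs) => // i ne_i; apply: le_c.
by apply: contraNneq ne_i => eq_i; apply/eqP/val_inj.
Qed.

Lemma smul_le f h n c : smul_summable f h n -> 0 <= c ->
  (forall k, v (smul_term f h n k) <= c) -> v (smul v f h n) <= c.
Proof.
move=> sum_fh c0 le_c; rewrite -[smul _ _ _ _](subrK (smul_term f h n 0)).
by apply: (vD_le v_abs) => //; apply: smul_sub_le.
Qed.

Lemma smulB f g h n : smul_summable f g n -> smul_summable f h n ->
  smul v f (g - h) n = smul v f g n - smul v f h n.
Proof.
move=> /smul_cvg/(abs_cvgP v_abs) cvg_g /smul_cvg/(abs_cvgP v_abs) cvg_h.
apply: (abs_lim_eq v_abs); apply/(abs_cvgP v_abs) => e e0.
have [N HN] := cvg_g e e0; have [N' HN'] := cvg_h e e0.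
exists (maxn N N') => m; rewrite geq_max => /andP[/HN lt_g /HN' lt_h].
have -> : \sum_(k < m) (f k%:Z * (g - h) (n - k%:Z) +
      f (- k.+1%:Z) * (g - h) (n + k.+1%:Z)) =
    \sum_(k < m) smul_term f g n k - \sum_(k < m) smul_term f h n k.
  rewrite -sumrB; apply: eq_bigr => k _; rewrite /smul_term !fctE.
  by rewrite !mulrBr opprD addrACA.
rewrite [X in v X](_ : _ =
  (\sum_(k < m) smul_term f g n k - smul v f g n) -
  (\sum_(k < m) smul_term f h n k - smul v f h n)); last by ring.
exact: (vB_lt v_abs).
Qed.

End SeriesProduct.

(** * The formal exponential and its differential equation *)

Section SeriesExp.
Variables (R : realType) (K : fieldType) (v : K -> R).
Hypothesis v_abs : is_ultrametric_abs v.
Hypothesis char0 : forall n, n.+1%:R != 0 :> K.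
Variable f : int -> K.
Hypotheses (f_nonneg : nonneg_series f) (f0 : f 0 = 0).

Lemma spow_nonneg k : nonneg_series (spow v f k).
Proof.
elim: k => [|k IH]; last exact: smul_nonneg.
by move=> n n0; rewrite /spow /= /sone /sconst lt_eqF.
Qed.

Lemma spow_coef k n i : (i <= n)%N ->
  spow v f k i%:Z = ((\poly_(j < n.+1) f j%:Z) ^+ k)`_i.
Proof.
elim: k i => [|k IH] i le_in; first by rewrite expr0 coef1 /spow /= /sone /sconst; case: i le_in.
rewrite /spow iterS -/(spow v f k) smul_coef //; last exact: spow_nonneg.
rewrite exprS coefM; apply: eq_bigr => j _.
rewrite coef_poly ltnS (leq_trans (leq_ord j) le_in) IH //.
exact: leq_trans (leq_subr _ _) le_in.
Qed.

Lemma sexp_nonneg : nonneg_series (sexp v f).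
Proof.
move=> n n0; apply: (@abs_lim_eventually _ _ _ v_abs _ _ 0) => M _.
by rewrite big1 // => k _; rewrite spow_nonneg // mulr0.
Qed.

Lemma sexp_coef n i : (i <= n)%N ->
  sexp v f i%:Z =
  (\sum_(k < n.+1) k`!%:R^-1 *: (\poly_(j < n.+1) f j%:Z) ^+ k)`_i.
Proof.
move=> le_in; apply: (@abs_lim_eventually _ _ _ v_abs _ _ n.+1) => M le_nM.
rewrite coef_sum.
rewrite (big_ord_widen M (fun k => (k`!%:R^-1 *: (\poly_(j < n.+1) f j%:Z) ^+ k)`_i)) //.
rewrite [RHS]big_mkcond; apply: eq_bigr => k _ /=.
rewrite (spow_coef k le_in) coefZ; case: ifP => // /negbT; rewrite -leqNgt => lt_nk.
(* As [f] has no constant term, [f^k] with [k > n] contributes nothing in degrees up to [n]. *)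
rewrite coef_exp_low ?mulr0 //; first by rewrite coef_poly.
exact: leq_ltn_trans le_in lt_nk.
Qed.

Lemma sexp0 : sexp v f 0 = 1.
Proof.
by rewrite (@sexp_coef 0 0) // big_ord1 fact0 invr1 scale1r expr0 coef1.
Qed.

(** This is [X exp(f)' = X f' exp(f)], coefficient by coefficient. *)
Lemma sexp_rec n : n%:R * sexp v f n%:Z =
  \sum_(i < n.+1) (i%:R * f i%:Z) * sexp v f (n - i)%N%:Z.
Proof.
rewrite (@sexp_coef n n) // -coef_Xderiv; set F := \poly_(j < _) _.
set G := \sum_(k < _) _.
have F0 : F`_0 = 0 by rewrite coef_poly.
(* The truncated exponential differentiates to [F'] times itself without its last term; that term
   times [X F'] has order above [n], so that restoring it does not change the coefficient. *)
have -> : 'X * G^`() = ('X * F^`()) * (G - n`!%:R^-1 *: F ^+ n).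
  have -> : G - n`!%:R^-1 *: F ^+ n = \sum_(k < n) k`!%:R^-1 *: F ^+ k.
    by rewrite /G big_ord_recr /= addrK.
  rewrite -mulrA; congr (_ * _); rewrite /G raddf_sum big_ord_recl /=.
  rewrite expr0 derivZ -polyC1 derivC scaler0 add0r mulr_sumr.
  apply: eq_bigr => k _; rewrite /bump leq0n add1n derivZ deriv_exp -scaler_nat scalerA -scalerAr /=.
  congr (_ *: _); rewrite factS natrM invfM mulrAC mulVf ?mul1r //.
rewrite mulrBr coefB -scalerAr coefZ [X in _ - _ * X]coefM big1 => [|i _].
  rewrite mulr0 subr0 coefM; apply: eq_bigr => i _.
  rewrite coef_Xderiv coef_poly ltn_ord (@sexp_coef n (n - i)) // leq_subr //.
case: i => -[|i] lt_i /=; first by rewrite coef_Xderiv mul0r mul0r.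
rewrite coef_exp_low ?mulr0 //; lia.
Qed.

End SeriesExp.

(** * The series h and one-units *)

Section HSeries.
Variables (R : realType) (p : nat) (K : fieldType) (v : K -> R).
Hypotheses (p_prime : prime p) (v_abs : is_ultrametric_abs v).
Hypothesis v_ratr : forall q : rat, v (ratr q) = padic_abs R p q.

Lemma l_series_coef n : n%:R * l_series K p n%:Z = (is_ppow p n)%:R.
Proof.
rewrite /= /is_ppow; case: existsP => [[k /eqP eq_k]|no_k]; last first.
  by rewrite big_pred0 ?mulr0 // => k; apply/negP => eq_k; apply: no_k; exists k.
rewrite (bigD1 k) /= ?eq_k // big1 => [|j /andP[/eqP eq_j ne_j]]; last first.
  case/eqP: ne_j; apply/val_inj/(expnI (prime_gt1 p_prime)).
  by rewrite [LHS]eq_j [RHS]eq_k.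
have p0 : p%:R != 0 :> K.
  by rewrite -(prednK (prime_gt0 p_prime)) (natr_neq0 p_prime v_abs v_ratr).
by rewrite addr0 -{1}eq_k natrX mulfV // expf_neq0.
Qed.

Lemma l_dilate_nonneg c : nonneg_series (sdilate c (l_series K p)).
Proof. by move=> [n|n] // _; rewrite /sdilate mul0r. Qed.

Lemma l_dilate0 c : sdilate c (l_series K p) 0 = 0.
Proof. by rewrite /sdilate /= big_mkcond big_ord1 expn0 /= mul0r. Qed.

Lemma h_series_nonneg c : nonneg_series (h_series v p c).
Proof. apply: sexp_nonneg => //; exact: l_dilate_nonneg. Qed.

Lemma h_series0 c : h_series v p c 0 = 1.
Proof. by apply: sexp0 => //; [exact: l_dilate_nonneg|exact: l_dilate0]. Qed.

Lemma h_series_rec c n : n%:R * h_series v p c n%:Z =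
  \sum_(i < n.+1) (is_ppow p i)%:R * c ^+ i * h_series v p c (n - i)%N%:Z.
Proof.
rewrite /h_series sexp_rec //.
- by apply: eq_bigr => i _; rewrite mulrA l_series_coef.
- exact: (natr_neq0 p_prime v_abs v_ratr).
- exact: l_dilate_nonneg.
- exact: l_dilate0.
Qed.

(** The value [1] lies outside the maximal ideal, but the exponential is formal; these are the
    coefficients of [E]. *)
Definition artin_hasse n : K := h_series v p 1 n%:Z.

Lemma artin_hasse_rec n : n%:R * artin_hasse n =
  \sum_(i < n.+1) (is_ppow p i)%:R * artin_hasse (n - i).
Proof. by rewrite h_series_rec; apply: eq_bigr => i _; rewrite expr1n mulr1. Qed.

Lemma artin_hasse_le1 n : v (artin_hasse n) <= 1.
Proof.
apply: (artin_hasse_integral p_prime v_abs v_ratr); first exact: h_series0.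
exact: artin_hasse_rec.
Qed.

Lemma artin_hasse1 : artin_hasse 1 = 1.
Proof.
have := h_series_rec 1 1; rewrite mul1r !big_ord_recl big_ord0 /= /artin_hasse => ->.
rewrite (is_ppow0 p_prime) (is_ppow_rec p_prime) /= !mul0r add0r addr0.
by rewrite mul1r expr1n mul1r h_series0.
Qed.

(** Either recursion determines its solution, [n] being invertible for [n > 0]; multiplying the
    second by [c^n = c^i c^(n-i)] gives the first. *)
Lemma ppow_rec_dilate c (x e : nat -> K) n : x 0 = 1 -> e 0 = 1 ->
  (forall m, m%:R * x m = \sum_(i < m.+1) (is_ppow p i)%:R * c ^+ i * x (m - i)%N) ->
  (forall m, m%:R * e m = \sum_(i < m.+1) (is_ppow p i)%:R * e (m - i)%N) ->
  x n = e n * c ^+ n.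
Proof.
move=> x0 e0 x_rec e_rec; elim/ltn_ind: n => -[|n] IH; first by rewrite x0 e0 mulr1.
apply: (mulfI (natr_neq0 p_prime v_abs v_ratr n)); rewrite mulrA x_rec e_rec.
rewrite mulr_suml [LHS]big_ord_recl [RHS]big_ord_recl (is_ppow0 p_prime) !mul0r.
congr (_ + _); apply: eq_bigr => i _; rewrite lift0 subSS.
rewrite IH ?ltnS ?leq_subr // -!mulrA; congr (_ * _).
rewrite mulrCA; congr (_ * _); rewrite -exprD; congr (_ ^+ _).
by have := ltn_ord i; lia.
Qed.

Lemma h_series_coef c n : h_series v p c n%:Z = artin_hasse n * c ^+ n.
Proof.
apply: (@ppow_rec_dilate c (fun m => h_series v p c m%:Z)).
- exact: h_series0.
- exact: h_series0.
- exact: h_series_rec.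
- exact: artin_hasse_rec.
Qed.

Lemma ssubst_nonneg m (f : int -> K) :
  (0 < m)%N -> nonneg_series f -> nonneg_series (ssubst_pow m f).
Proof.
move=> m0 f0 n n0; rewrite /ssubst_pow; case: ifP => // mn; apply: f0.
by have := divzK mn; nia.
Qed.

Lemma ssubst_coef m (f : int -> K) (n : nat) :
  ssubst_pow m f n%:Z = if (m %| n)%N then f (n %/ m)%N%:Z else 0.
Proof. by rewrite /ssubst_pow dvdzE /= divz_nat. Qed.

Definition h_factor m c : int -> K := ssubst_pow m (h_series v p c).

Lemma h_factor_nonneg m c : (0 < m)%N -> nonneg_series (h_factor m c).
Proof. by move=> m0; apply: ssubst_nonneg => //; exact: h_series_nonneg. Qed.

Lemma h_factor0 m c : h_factor m c 0 = 1.
Proof. by rewrite /h_factor (ssubst_coef _ _ 0) dvdn0 div0n h_series0. Qed.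

Lemma h_factor_coef m c (n : nat) : h_factor m c n%:Z =
  if (m %| n)%N then artin_hasse (n %/ m) * c ^+ (n %/ m) else 0.
Proof. by rewrite /h_factor ssubst_coef h_series_coef. Qed.

Lemma h_factor_le_exp m c (rho : R) (n : nat) : 0 <= rho ->
  v c <= rho ^+ m -> v (h_factor m c n%:Z) <= rho ^+ n.
Proof.
move=> rho0 c_le; rewrite h_factor_coef.
case: ifP => [mn|_]; last by rewrite (v0 v_abs) exprn_ge0.
rewrite (vM v_abs) (vX v_abs) -[leRHS]mul1r ler_pM ?exprn_ge0 ?(vge0 v_abs) ?artin_hasse_le1 //.
rewrite -{2}(divnK mn) mulnC exprM.
by apply: lerXn2r; rewrite ?nnegrE ?(vge0 v_abs) ?exprn_ge0.
Qed.

Lemma h_factor_le m c r (n : nat) : v c <= r -> r <= 1 -> (0 < n)%N ->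
  v (h_factor m c n%:Z) <= r.
Proof.
move=> cr r1 n0; have r0 : 0 <= r by apply: le_trans cr; exact: vge0.
rewrite h_factor_coef; case: ifP => [mn|_]; last by rewrite (v0 v_abs).
have m0 := dvdn_gt0 n0 mn.
have d0 : (0 < n %/ m)%N by rewrite (divn_gt0 _ m0); exact: dvdn_leq.
rewrite (vM v_abs) (vX v_abs) -[leRHS]mul1r ler_pM ?exprn_ge0 ?(vge0 v_abs) ?artin_hasse_le1 //.
rewrite -(prednK d0) exprS -[leRHS]mulr1 ler_pM ?exprn_ge0 ?(vge0 v_abs) //.
by rewrite exprn_ile1 ?(vge0 v_abs) // (le_trans cr).
Qed.

(** With an exponent at least [2], the cofactor of [x - y] consists of monomials of positive degree
    in [x] and [y], whence the extra factor [r]. *)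
Lemma v_subX_le x y r d n : v x <= r -> v y <= r -> r <= 1 -> v (x - y) <= d ->
  v (x ^+ n.+2 - y ^+ n.+2) <= d * r.
Proof.
move=> xr yr r1 xyd; have r0 : 0 <= r by apply: le_trans xr; exact: vge0.
rewrite subrXX (vM v_abs) ler_pM ?(vge0 v_abs) //.
apply: (v_sum_le v_abs) => // i _; rewrite (vM v_abs) !(vX v_abs).
have exp_le z k : v z <= r -> v z ^+ k.+1 <= r.
  move=> zr; rewrite exprS -[leRHS]mulr1 ler_pM ?exprn_ge0 ?(vge0 v_abs) //.
  by rewrite exprn_ile1 ?(vge0 v_abs) // (le_trans zr).
case: (posnP i) => [->|i0].
  by rewrite subn0 expr0 mulr1; exact: exp_le.
rewrite -(prednK i0) -[leRHS]mul1r ler_pM ?exprn_ge0 ?(vge0 v_abs) ?exp_le //.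
by rewrite exprn_ile1 ?(vge0 v_abs) // (le_trans xr).
Qed.

(** In degree [k m] the difference is [e_k (c^k - c'^k)], with [e] the coefficients of [E]: zero for
    [k = 0], exactly [c - c'] for [k = 1], and smaller by a factor [r] for [k >= 2]. *)
Lemma h_factor_diff m c c' r d (n : nat) : (0 < m)%N ->
  v c <= r -> v c' <= r -> r <= 1 -> v (c - c') <= d ->
  v (h_factor m c n%:Z - h_factor m c' n%:Z - (n == m)%:R * (c - c')) <= d * r.
Proof.
move=> m0 cr c'r r1 cd; have r0 : 0 <= r by apply: le_trans cr; exact: vge0.
have d0 : 0 <= d by apply: le_trans cd; exact: vge0.
have dr0 : 0 <= d * r by exact: mulr_ge0.
rewrite !h_factor_coef; case: ifP => [/dvdnP[k ->]|/negP mn]; last first.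
  case: eqP => [eq_nm|_]; first by case: mn; rewrite eq_nm.
  by rewrite mul0r !subr0 (v0 v_abs).
rewrite mulnK //; case: k => [|[|k]].
- by rewrite mul0n !expr0 subrr (ltn_eqF m0) mul0r subr0 (v0 v_abs).
- by rewrite mul1n eqxx !expr1 artin_hasse1 !mul1r subrr (v0 v_abs).
rewrite (_ : (k.+2 * m == m)%N = false); last by apply/eqP; nia.
rewrite mul0r subr0 -mulrBr (vM v_abs) -[leRHS]mul1r.
by rewrite ler_pM ?(vge0 v_abs) ?artin_hasse_le1 ?v_subX_le.
Qed.

End HSeries.

(** * One-units with small coefficients and their inverses *)

Section OneUnits.
Variables (R : realType) (K : fieldType) (v : K -> R).
Hypothesis v_abs : is_ultrametric_abs v.
Implicit Types f g h : int -> K.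

Definition one_unit f := nonneg_series f /\ f 0 = 1.

Lemma one_unit_sone : one_unit (sone K).
Proof. by split=> [n n0|]; rewrite /sone /sconst ?eqxx ?lt_eqF. Qed.

Lemma one_unit_smul f h : one_unit f -> one_unit h -> one_unit (smul v f h).
Proof.
by move=> [f0 f1] [h0 h1]; split; [exact: smul_nonneg|rewrite smul_coef0 // f1 h1 mulr1].
Qed.

Lemma smul_le_exp f h rho (n : nat) : 0 <= rho ->
  nonneg_series f -> nonneg_series h ->
  (forall k : nat, v (f k%:Z) <= rho ^+ k) ->
  (forall k : nat, v (h k%:Z) <= rho ^+ k) ->
  v (smul v f h n%:Z) <= rho ^+ n.
Proof.
move=> rho0 f0 h0 f_le h_le; rewrite smul_coef //.
apply: (v_sum_le v_abs) => [|i _]; first exact: exprn_ge0.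
rewrite (vM v_abs) -[X in _ <= rho ^+ X](subnKC (leq_ord i)) exprD.
by rewrite ler_pM ?(vge0 v_abs).
Qed.

Lemma one_unit_le1 f r (n : nat) : one_unit f -> r <= 1 ->
  (forall k : nat, (0 < k)%N -> v (f k%:Z) <= r) -> v (f n%:Z) <= 1.
Proof.
move=> [_ f1] r1 f_le; case: n => [|n]; first by rewrite f1 (v1 v_abs).
by apply: le_trans r1; exact: f_le.
Qed.

Lemma smul_one_unit_le f h r (n : nat) : 0 <= r -> r <= 1 ->
  one_unit f -> one_unit h ->
  (forall k : nat, (0 < k)%N -> v (f k%:Z) <= r) ->
  (forall k : nat, (0 < k)%N -> v (h k%:Z) <= r) ->
  (0 < n)%N -> v (smul v f h n%:Z) <= r.
Proof.
move=> r0 r1 f1 h1 f_le h_le n0; rewrite smul_coef //; [|by case: f1|by case: h1].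
apply: (v_sum_le v_abs) => // i _; rewrite (vM v_abs).
case: (posnP i) => [->|i0].
  rewrite -[leRHS]mul1r ler_pM ?(vge0 v_abs) ?(one_unit_le1 _ f1 r1) //.
  by rewrite subn0 h_le.
by rewrite -[leRHS]mulr1 ler_pM ?(vge0 v_abs) ?(one_unit_le1 _ h1 r1) ?f_le.
Qed.

(** Write [f h - f' h' = (f - f') h + f' (h - h')]: the constant terms of [h] and [f'] give the
    linear part, and every other term carries a coefficient of [h] or [f'] of positive degree. *)
Lemma smul_one_unit_diff f f' h h' r d (n : nat) : 0 <= r -> 0 <= d ->
  one_unit f -> one_unit f' -> one_unit h -> one_unit h' ->
  (forall k : nat, (0 < k)%N -> v (f' k%:Z) <= r) ->
  (forall k : nat, (0 < k)%N -> v (h k%:Z) <= r) ->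
  (forall k : nat, v (f k%:Z - f' k%:Z) <= d) ->
  (forall k : nat, v (h k%:Z - h' k%:Z) <= d) ->
  v (smul v f h n%:Z - smul v f' h' n%:Z -
     ((f n%:Z - f' n%:Z) + (h n%:Z - h' n%:Z))) <= d * r.
Proof.
move=> r0 d0 [f0 f1] [f'0 f'1] [h0 h1] [h'0 h'1] f'r hr fd hd.
rewrite !smul_coef // -sumrB.
have -> : \sum_(i < n.+1) (f i * h (n - i)%N - f' i * h' (n - i)%N) =
    \sum_(i < n.+1) (f i - f' i) * h (n - i)%N +
    \sum_(i < n.+1) f' i * (h (n - i)%N - h' (n - i)%N).
  by rewrite -big_split; apply: eq_bigr => i _ /=; ring.
rewrite big_ord_recr [X in _ + X - _]big_ord_recl /= subnn subn0 h1 f'1 mulr1 mul1r.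
set s1 := \sum_(i < n) _; set s2 := \sum_(i < n) _; set x := f n - f' n; set y := h n - h' n.
have -> : s1 + x + (y + s2) - (x + y) = s1 + s2 by ring.
have dr0 : 0 <= d * r by exact: mulr_ge0.
apply: (vD_le v_abs); apply: (v_sum_le v_abs) => // i _.
  by rewrite (vM v_abs) ler_pM ?(vge0 v_abs) // hr // subn_gt0.
by rewrite (vM v_abs) mulrC ler_pM ?(vge0 v_abs) // f'r.
Qed.

(** A bound [M] is asked for because [sup] takes a default value on unbounded sets. *)
Lemma le_snorm f (M : R) i : (forall j, v (f j) <= M) -> v (f i) <= snorm v f.
Proof.
move=> fM; apply: ub_le_sup; last by exists i.
by exists M => _ [j _ <-]; exact: fM.
Qed.

Lemma snorm_eq1 f : (forall i, v (f i) <= 1) -> v (f 0) = 1 -> snorm v f = 1.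
Proof.
move=> f1 f0; apply/eqP; rewrite eq_le; apply/andP; split.
  apply: ge_sup; first by exists (v (f 0)), 0.
  by move=> _ [j _ <-]; exact: f1.
by rewrite -f0; exact: (le_snorm 0 f1).
Qed.

(** Coefficients of the inverse in reverse order, the latest at the head, so that the convolution
    [sum_i f_(i+1) g_(m-i)] reads the list from the left. *)
Fixpoint inv_coefs f (n : nat) : seq K :=
  if n is m.+1 then
    - (\sum_(i < n) f i.+1%:Z * nth 0 (inv_coefs f m) i) :: inv_coefs f m
  else [:: 1].

Definition sinv f : int -> K := fun n =>
  if n is Posz m then head 0 (inv_coefs f m) else 0.

Lemma nth_inv_coefs f n i : (i <= n)%N ->
  nth 0 (inv_coefs f n) i = sinv f (n - i)%N%:Z.
Proof.
elim: n i => [|n IH] [|i] //.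
by move=> le_in; rewrite subSS -IH.
Qed.

Lemma sinv_nonneg f : nonneg_series (sinv f). Proof. by case. Qed.

Lemma sinvS f n :
  sinv f n.+1%:Z = - \sum_(i < n.+1) f i.+1%:Z * sinv f (n - i)%N%:Z.
Proof.
congr (- _); apply: eq_bigr => i _.
by rewrite -(nth_inv_coefs f (leq_ord i)).
Qed.

Lemma smul_sinv f : one_unit f -> smul v f (sinv f) = sone K.
Proof.
move=> [f0 f1]; have g0 := @sinv_nonneg f; apply/funext => -[[|n]|n]; last by rewrite smul_nonneg.
  by rewrite smul_coef0 // f1 mul1r.
rewrite smul_coef // big_ord_recl f1 mul1r subn0 sinvS /= /sone /sconst /=.
by apply/eqP; rewrite addrC subr_eq0; apply/eqP/eq_bigr.
Qed.

Lemma sinv_le_exp f rho (n : nat) : 0 <= rho ->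
  (forall k : nat, v (f k%:Z) <= rho ^+ k) -> v (sinv f n%:Z) <= rho ^+ n.
Proof.
move=> rho0 f_le; elim/ltn_ind: n => -[|n] IH; first by rewrite /= (v1 v_abs).
rewrite sinvS (vN v_abs); apply: (v_sum_le v_abs) => [|i _]; first exact: exprn_ge0.
rewrite (vM v_abs) -[in X in _ <= X](subnKC (leq_ord i)) -addSn exprD.
by rewrite ler_pM ?(vge0 v_abs) // IH // ltnS leq_subr.
Qed.

Lemma expr_lt_eventually (rho e : R) : 0 <= rho < 1 -> 0 < e ->
  exists N, forall n, (N <= n)%N -> rho ^+ n < e.
Proof.
move=> /andP[rho0 rho1]; apply: (cvg_to0P _).1 => [n|]; first exact: exprn_ge0.
by apply: cvg_expr; rewrite ger0_norm.
Qed.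

Lemma Hfield_of_le_exp f rho : 0 <= rho < 1 -> nonneg_series f ->
  (forall k : nat, v (f k%:Z) <= rho ^+ k) -> Hfield v f.
Proof.
move=> rho01 f0 f_le; have /andP[rho0 rho1] := rho01; split.
  exists 1 => -[n|n]; last by rewrite f0 // (v0 v_abs).
  by apply: le_trans (f_le n) _; rewrite exprn_ile1 // ltW.
apply/(cvg_to0P (fun n => vge0 v_abs _)) => e e0.
have [N HN] := expr_lt_eventually rho01 e0.
by exists N => n /HN; apply: le_lt_trans.
Qed.

(** The inverse [sinv f] obeys the same geometric bound as [f], and therefore lies in [H]. *)
Lemma Gamma_one_unit f rho : 0 <= rho < 1 -> one_unit f ->
  (forall k : nat, v (f k%:Z) <= rho ^+ k) -> Gamma_rho v rho f.
Proof.
move=> rho01 f1 f_le; have [f_nonneg f_0] := f1; have /andP[rho0 rho1] := rho01.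
split=> //.
- split; first exact: Hfield_of_le_exp rho01 _ f_le.
  exists (sinv f); last exact: smul_sinv.
  apply: Hfield_of_le_exp rho01 (@sinv_nonneg f) _ => k.
  exact: sinv_le_exp.
- apply: snorm_eq1; last by rewrite f_0 (v1 v_abs).
  move=> -[n|n]; last by rewrite f_nonneg // (v0 v_abs).
  by apply: le_trans (f_le n) _; rewrite exprn_ile1 // ltW.
- by rewrite f_0 (v1 v_abs).
Qed.

End OneUnits.

(** * Comparison of coefficients *)

Section HMu.
Variables (R : realType) (p : nat) (K : fieldType) (v : K -> R).
Hypotheses (p_prime : prime p) (v_abs : is_ultrametric_abs v).
Hypothesis v_ratr : forall q : rat, v (ratr q) = padic_abs R p q.
Variables (I : Type) (m : I -> nat).
Hypothesis m_gt0 : forall i, (0 < m i)%N.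
Implicit Types (c : I -> K) (s : seq I).

(** Taken over an arbitrary list so that inductions can peel off one factor; [h_mu] is the case of
    all indices. *)
Definition h_prod s c : int -> K :=
  \big[smul v/sone K]_(i <- s) h_factor p v (m i) (c i).

Lemma h_prod_nil c : h_prod [::] c = sone K.
Proof. exact: big_nil. Qed.

Lemma h_prod_cons i s c :
  h_prod (i :: s) c = smul v (h_factor p v (m i) (c i)) (h_prod s c).
Proof. exact: big_cons. Qed.

Lemma h_factor_one_unit i x : one_unit (h_factor p v (m i) x).
Proof. by split; [exact: h_factor_nonneg|exact: h_factor0]. Qed.

Lemma h_prod_one_unit s c : one_unit (h_prod s c).
Proof.
apply: (big_ind (@one_unit K)); [exact: one_unit_sone|exact: one_unit_smul|].
by move=> i _; exact: h_factor_one_unit.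
Qed.

Lemma h_prod_le_exp s c rho (n : nat) : 0 <= rho ->
  (forall i, v (c i) <= rho ^+ m i) -> v (h_prod s c n%:Z) <= rho ^+ n.
Proof.
move=> rho0 c_le; elim: s n => [|i s IH] n.
  rewrite h_prod_nil /sone /sconst; case: eqP => [[->]|_].
    by rewrite (v1 v_abs) expr0.
  by rewrite (v0 v_abs) exprn_ge0.
rewrite h_prod_cons; apply: smul_le_exp => //.
- by case: (h_factor_one_unit i (c i)).
- by case: (h_prod_one_unit s c).
by move=> k; exact: h_factor_le_exp.
Qed.

Lemma h_prod_le s c r (n : nat) : 0 <= r -> r <= 1 ->
  (forall i, v (c i) <= r) -> (0 < n)%N -> v (h_prod s c n%:Z) <= r.
Proof.
move=> r0 r1 c_le; elim: s n => [|i s IH] n n0.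
  by rewrite h_prod_nil /sone /sconst; case: n n0 => //= n _; rewrite (v0 v_abs).
rewrite h_prod_cons; apply: smul_one_unit_le => //.
- exact: h_factor_one_unit.
- exact: h_prod_one_unit.
by move=> k k0; exact: h_factor_le.
Qed.

Lemma h_prod_diff s c c' r d (n : nat) : 0 <= r -> r <= 1 -> 0 <= d ->
  (forall i, v (c i) <= r) -> (forall i, v (c' i) <= r) ->
  (forall i, v (c i - c' i) <= d) ->
  v (h_prod s c n%:Z - h_prod s c' n%:Z -
     \sum_(i <- s) (n == m i)%:R * (c i - c' i)) <= d * r.
Proof.
move=> r0 r1 d0 cr c'r cd; have dr0 : 0 <= d * r by exact: mulr_ge0.
have dr_d : d * r <= d by rewrite ler_piMr.
have delta_le (b : bool) i : v (b%:R * (c i - c' i)) <= d.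
  by case: b; rewrite ?mul1r ?mul0r ?(v0 v_abs).
elim: s n => [|i s IH] n.
  by rewrite !h_prod_nil big_nil subrr subr0 (v0 v_abs).
rewrite !h_prod_cons big_cons.
set f := h_factor _ _ _ _; set f' := h_factor _ _ _ _.
have f_diff k : v (f k%:Z - f' k%:Z - (k == m i)%:R * (c i - c' i)) <= d * r.
  exact: h_factor_diff.
set x := f n - f' n; set y := h_prod s c n - h_prod s c' n.
set z := _ * _; set t := \sum_(j <- s) _.
(* The error splits into that of linearizing the product of two one-units, that of the first factor
   and that of the remaining product. *)
have alg (q x' y' z' t' : K) :
  q - (z' + t') = q - (x' + y') + (x' - z') + (y' - t') by ring.
rewrite (alg _ x y).
apply: (vD_le v_abs); last exact: IH.
apply: (vD_le v_abs); last exact: f_diff.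
apply: smul_one_unit_diff => //; try exact: h_factor_one_unit; try exact: h_prod_one_unit.
- by move=> k k0; exact: h_factor_le.
- by move=> k k0; exact: h_prod_le.
- move=> k; rewrite -[_ - _](subrK ((k == m i)%:R * (c i - c' i))).
  by apply: (vD_le v_abs) => //; exact: le_trans (f_diff k) dr_d.
move=> k; rewrite -[_ - _](subrK (\sum_(j <- s) (k == m j)%:R * (c j - c' j))).
apply: (vD_le v_abs); first exact: le_trans (IH k) dr_d.
exact: (v_sum_le v_abs).
Qed.

End HMu.

(** From some [N] on the values stay below half of [x n0], so that the maximum over positive indices
    is attained, and for the last time at some [nu]. The finitely many later values before [N],
    together with that half, give a uniform [c] below the maximum. *)
Lemma max_positive_index (R : realType) (x : nat -> R) n0 :
  (forall e, 0 < e -> exists N, forall n, (N <= n)%N -> x n < e) ->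
  (0 < n0)%N -> 0 < x n0 ->
  exists nu, [/\ (0 < nu)%N, 0 < x nu, forall n, (0 < n)%N -> x n <= x nu &
    exists2 c, 0 <= c < x nu & forall n, (nu < n)%N -> x n <= c].
Proof.
move=> x_cvg n0_gt0 xn0; have half : 0 < x n0 / 2 by rewrite divr_gt0.
have half_lt : x n0 / 2 < x n0 by rewrite ltr_pdivrMr // mulr_natr mulr2n ltrDl.
have [N HN] := x_cvg _ half.
have lt_n0N : (n0 < N)%N.
  by rewrite ltnNge; apply/negP => /HN; rewrite ltNge (ltW half_lt).
pose P (i : 'I_N) := (0 < i)%N; pose F (i : 'I_N) := x i.
have P0 : P (Ordinal lt_n0N) by [].
case: (@arg_maxP _ _ _ (Ordinal lt_n0N) P F P0) => i Pi i_max.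
have le_max n : (0 < n)%N -> x n <= x i.
  move=> n_gt0; have le_n0 : x n0 <= x i by exact: (i_max (Ordinal lt_n0N)).
  have [lt_nN|le_Nn] := ltnP n N; first exact: (i_max (Ordinal lt_nN)).
  by apply: le_trans le_n0; apply/ltW/(lt_trans (HN _ le_Nn)).
pose Q n := (0 < n)%N && (x n == x i).
have exQ : exists n, Q n by exists i; rewrite /Q eqxx andbT.
have ubQ n : Q n -> (n <= N)%N.
  move=> /andP[_ /eqP eq_n]; rewrite leqNgt; apply/negP => /ltnW /HN.
  by rewrite eq_n ltNge (le_trans (ltW half_lt)) // le_max.
case: (ex_maxnP exQ ubQ) => nu /andP[nu0 /eqP eq_nu] nu_max.
have xi_gt : x n0 <= x i by exact: le_max.
exists nu; split=> //; first by rewrite eq_nu (lt_le_trans xn0).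
  by move=> n; rewrite eq_nu; exact: le_max.
exists (\big[Num.max/x n0 / 2]_(j < N | (nu < j)%N) x j).
  apply/andP; split; first by apply: (le_trans (ltW half)); exact: bigmax_ge_id.
  rewrite eq_nu; apply: bigmax_lt => [|j lt_j]; first exact: lt_le_trans xi_gt.
  have j0 : (0 < j)%N by exact: leq_ltn_trans lt_j.
  rewrite lt_neqAle le_max // andbT; apply: contraTneq lt_j => eq_j.
  by rewrite -leqNgt nu_max // /Q j0 eq_j eqxx.
move=> n lt_n; have [lt_nN|le_Nn] := ltnP n N.
  exact: (@le_bigmax_cond _ _ _ _ (Ordinal lt_nN) _ (fun j : 'I_N => x j)).
by apply: le_trans (ltW (HN _ le_Nn)) _; exact: bigmax_ge_id.
Qed.

(** * Coefficients at gaps, in [A] and in its closure *)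

Section AnalyticClosure.
Variables (R : realType) (K : fieldType) (v : K -> R).
Hypothesis v_abs : is_ultrametric_abs v.

(** In degree [s_j] the earlier basis elements are too short and the later ones are reduced, so that
    only [w_j] contributes. *)
Lemma standard_basis_coef (A : set (int -> K)) s w N (c : nat -> K) j :
  is_standard_basis A s w -> (j < N)%N ->
  (\sum_(i < N) sscale (c i) (w i)) (s j)%:Z = c j.
Proof.
move=> [s_inc _ _ w_deg w_red] lt_jN.
rewrite fct_sumE (bigD1 (Ordinal lt_jN)) //= big1 => [|i ne_i].
  by rewrite /sscale (w_deg j).2 mulr1 addr0.
rewrite /sscale; case: (ltngtP i j) => [lt_ij|lt_ji|eq_ij].
- by rewrite (w_deg i).1.2 ?mulr0 // ltz_nat s_inc.
- by rewrite w_red ?mulr0.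
- by case/eqP: ne_i; apply/val_inj.
Qed.

Lemma Hfield_sub_le_snorm f h i : Hfield v f -> Hfield v h ->
  v (f i - h i) <= snorm v (f - h).
Proof.
move=> [[M fM] _] [[M' hM'] _].
apply: (@le_snorm _ _ v (f - h) (Num.max M M') i) => j.
by apply: (vB_le v_abs); rewrite le_max ?fM ?hM' ?orbT.
Qed.

(** Approximate [a] by some [a'] in [A], whose coordinate along [w_i] is its coefficient at [s_i].
    If [s_i > nu], this coordinate is at most [c] up to the approximation, and [w_i] is integral; if
    [s_i < nu], then [w_i] does not reach degree [nu]; and no [s_i] equals a gap. *)
Lemma analytic_closure_gap A a (nu : nat) c : strictly_integral v A ->
  analytic_closure v A a -> ~ degrees A nu%:Z ->
  (forall n : nat, (nu < n)%N -> v (a n%:Z) <= c) -> 0 <= c -> v (a nu%:Z) <= c.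
Proof.
move=> [s [w [std w_int]]] [aH a_approx] gap a_le c0.
have [_ deg_s [_ w_gen _] w_deg _] := std.
apply/ler_addgt0Pr => e e0; have ce : c <= c + e by rewrite lerDl ltW.
have ec : e <= c + e by rewrite lerDr.
have [a' [a'A a'H] lt_e] := a_approx e e0.
have near i : v (a i - a' i) <= c + e.
  by apply: le_trans ec; apply: le_trans (ltW lt_e); exact: Hfield_sub_le_snorm.
suff a'_le : v (a' nu%:Z) <= c + e.
  by rewrite -[a _](subrK (a' nu%:Z)); exact: (vD_le v_abs).
have [N [b eq_a']] := w_gen a' a'A.
rewrite eq_a' fct_sumE; apply: (v_sum_le v_abs) => [|i _].
  exact: le_trans ce.
rewrite /sscale; case: (ltngtP (s i) nu) => [lt_s|gt_s|eq_s].
- by rewrite (w_deg i).1.2 ?mulr0 ?(v0 v_abs) ?(le_trans c0) // ltz_nat.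
- rewrite (vM v_abs) -[leRHS]mulr1 ler_pM ?(vge0 v_abs) //.
  rewrite -(standard_basis_coef b std (ltn_ord i)) -eq_a'.
  rewrite -[a' _](subKr (a (s i)%:Z)); apply: (vB_le v_abs) => //.
  by apply: le_trans ce; exact: a_le.
- by case: gap; rewrite deg_s; exists i => //; rewrite eq_s.
Qed.

End AnalyticClosure.

(** * Reading [h - h'] off the coefficients of [a] of positive degree *)

Section UnitFactor.
Variables (R : realType) (K : fieldType) (v : K -> R).
Hypotheses (v_abs : is_ultrametric_abs v) (v_complete : abs_complete v).
Variables (h h' a b : int -> K) (r : R).
Hypotheses (r0 : 0 <= r) (r1 : r < 1).
Hypotheses (h_unit : one_unit h) (h'_unit : one_unit h').
Hypothesis h'_le : forall k : nat, (0 < k)%N -> v (h' k%:Z) <= r.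
Hypothesis h'_cvg : forall e, 0 < e ->
  exists N, forall n : nat, (N <= n)%N -> v (h' n%:Z) < e.
Hypothesis a_le1 : forall i, v (a i) <= 1.
Hypothesis a_cvg : forall e, 0 < e ->
  exists N, forall n : nat, (N <= n)%N -> v (a n%:Z) < e.
Hypothesis b_le1 : forall i, v (b i) <= 1.
Hypothesis b_pos : forall i, 0 < i -> b i = 0.
Hypothesis b_0 : v (b 0) = 1.
Hypothesis h_eq : h = smul v h' (smul v a b).

(** The equation [h = h' u] is used in the form [h - h' = h' w] with [w = u - 1], by linearity in
    the right factor. *)
Let u := smul v a b.
Let w := u - sone K.

(** For large [k] the terms with negative index in [a] meet [b] in positive degree, where it
    vanishes; the others are controlled by [a] tending to zero. *)
Lemma summable_ab n : smul_summable v a b n.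
Proof.
move=> e e0; have [N HN] := a_cvg e0; exists (maxn N `|n|) => k.
rewrite geq_max => /andP[Nk nk]; rewrite /smul_term [X in _ + _ * X]b_pos; last by lia.
rewrite mulr0 addr0 (vM v_abs); apply: le_lt_trans (HN _ Nk).
by rewrite ler_piMr ?(vge0 v_abs).
Qed.

Lemma u_le1 n : v (u n) <= 1.
Proof.
apply: (smul_le v_abs v_complete) => //; first exact: summable_ab.
move=> k; rewrite /smul_term; apply: (vD_le v_abs); rewrite (vM v_abs);
  by rewrite -[1]mulr1 ler_pM ?(vge0 v_abs).
Qed.

Lemma w_le1 n : v (w n) <= 1.
Proof.
apply: (vB_le v_abs); first exact: u_le1.
by rewrite /sone /sconst; case: eqP => _; rewrite ?(v0 v_abs) ?(v1 v_abs).
Qed.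

Lemma smul_term_h' g n k : smul_term h' g n k = h' k%:Z * g (n - k%:Z).
Proof. by rewrite /smul_term [X in _ + X * _]h'_unit.1 // mul0r addr0. Qed.

Lemma summable_h' g n : (forall i, v (g i) <= 1) -> smul_summable v h' g n.
Proof.
move=> g1 e e0; have [N HN] := h'_cvg e0; exists N => k Nk.
rewrite smul_term_h' (vM v_abs); apply: le_lt_trans (HN _ Nk).
by rewrite ler_piMr ?(vge0 v_abs).
Qed.

Lemma h'_w n : h n - h' n = smul v h' w n.
Proof.
rewrite smulB //; first by rewrite smuls1 // h_eq.
  by apply: summable_h' => i; exact: u_le1.
apply: summable_h' => i.
by rewrite /sone /sconst; case: eqP => _; rewrite ?(v0 v_abs) ?(v1 v_abs).
Qed.

(* The coefficients of [h' w = h - h'] vanish in degrees [<= 0], so that a bound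
   on [w] in these degrees can be improved by the factor [r] indefinitely. *)
Lemma w_nonpos n : n <= 0 -> w n = 0.
Proof.
have w_le k i : i <= 0 -> v (w i) <= r ^+ k.
  elim: k i => [|k IH] i i0; first by rewrite expr0 w_le1.
  have : v (smul v h' w i - smul_term h' w i 0) <= r ^+ k.+1.
    apply: (smul_sub_le v_abs v_complete) => //; first by apply: summable_h'; exact: w_le1.
      exact: exprn_ge0.
    move=> j j0; rewrite smul_term_h' (vM v_abs) exprS ler_pM ?(vge0 v_abs) //.
      by rewrite h'_le // lt0n.
    by apply: IH; lia.
  rewrite -h'_w smul_term_h' h'_unit.2 mul1r subr0 (_ : h i = h' i) ?subrr ?sub0r ?(vN v_abs) //.
  case: i i0 => [[|i]|i] // _; first by rewrite h_unit.2 h'_unit.2.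
  by rewrite h_unit.1 // h'_unit.1.
move=> n_le0; apply/eqP; rewrite -(v_eq0 v_abs) eq_le (vge0 v_abs) andbT.
apply/ler_addgt0Pl => e e0; rewrite addr0.
have [|N HN] := @expr_lt_eventually _ r e _ e0; first by rewrite r0.
by apply: le_trans (ltW (HN N (leqnn _))); exact: w_le.
Qed.

Lemma w_pos n : 0 < n -> w n = u n.
Proof. by move=> n0; rewrite /w !fctE /sone /sconst gt_eqF // subr0. Qed.

(** Since [b] has no positive part, a coefficient of [a b] in positive degree involves [a] in that
    degree and above only. *)
Lemma smul_term_ab (n k : nat) : smul_term a b n.+1%:Z k =
  if (k <= n)%N then 0 else a k%:Z * b (n.+1%:Z - k%:Z).
Proof.
rewrite /smul_term [X in _ + _ * X]b_pos // mulr0 addr0.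
by case: ifP => // le_kn; rewrite b_pos ?mulr0 //; lia.
Qed.

Section Bound.
Variable alpha : R.
Hypothesis alpha0 : 0 <= alpha.
Hypothesis a_le : forall n : nat, (0 < n)%N -> v (a n%:Z) <= alpha.

Lemma w_le n : v (w n) <= alpha.
Proof.
have [n0|n0] := leP n 0; first by rewrite w_nonpos // (v0 v_abs).
rewrite w_pos //; case: n n0 => [[|n]|n] // _.
apply: (smul_le v_abs v_complete) => //; first exact: summable_ab.
move=> k; rewrite smul_term_ab; case: leqP => [_|lt_nk]; first by rewrite (v0 v_abs).
by rewrite (vM v_abs) -[alpha]mulr1 ler_pM ?(vge0 v_abs) // a_le // (leq_ltn_trans _ lt_nk).
Qed.

(** Every term of [h' w] other than the one with the constant term [1] of [h'] carries a coefficient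
    of [h'] bounded by [r]. *)
Lemma diff_sub_w_le n : v (h n - h' n - w n) <= r * alpha.
Proof.
have -> : w n = smul_term h' w n 0 by rewrite smul_term_h' h'_unit.2 mul1r subr0.
rewrite h'_w; apply: (smul_sub_le v_abs v_complete) => //; first by apply: summable_h'; exact: w_le1.
  exact: mulr_ge0.
move=> k k0; rewrite smul_term_h' (vM v_abs) ler_pM ?(vge0 v_abs) ?w_le //.
by rewrite h'_le // lt0n.
Qed.

Lemma diff_le n : v (h n - h' n) <= alpha.
Proof.
rewrite -[_ - _](subrK (w n)); apply: (vD_le v_abs); last exact: w_le.
by apply: le_trans (diff_sub_w_le n) _; rewrite ler_piMl // ltW.
Qed.

(** In degree [nu] the term [a_nu b_0] dominates [a b], the others being at most [c]; multiplication
    by [h'] then changes it by at most [r alpha < alpha]. *)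
Lemma diff_eq (nu : nat) c : (0 < nu)%N -> v (a nu%:Z) = alpha ->
  0 <= c < alpha -> (forall n : nat, (nu < n)%N -> v (a n%:Z) <= c) ->
  v (h nu%:Z - h' nu%:Z) = alpha.
Proof.
case: nu => // nu _ a_nu /andP[c0 c_lt] a_c.
have t_nu : smul_term a b nu.+1%:Z nu.+1 = a nu.+1%:Z * b 0.
  by rewrite smul_term_ab ltnn subrr.
have v_t : v (a nu.+1%:Z * b 0) = alpha by rewrite (vM v_abs) a_nu b_0 mulr1.
have v_w : v (w nu.+1%:Z) = alpha.
  rewrite w_pos // -v_t; apply: (v_dominant v_abs); rewrite v_t.
  apply: le_lt_trans c_lt; rewrite -t_nu; apply: (smul_sub_le v_abs v_complete) => //.
    exact: summable_ab.
  move=> k ne_k; rewrite smul_term_ab; case: leqP => [_|lt_k]; first by rewrite (v0 v_abs).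
  rewrite (vM v_abs) -[c]mulr1 ler_pM ?(vge0 v_abs) // a_c //.
  by rewrite ltn_neqAle eq_sym ne_k.
rewrite -[RHS]v_w; apply: (v_dominant v_abs); rewrite v_w.
apply: le_lt_trans (diff_sub_w_le _) _.
by rewrite -[ltRHS]mul1r ltr_pM2r // (le_lt_trans c0).
Qed.

End Bound.
End UnitFactor.

Lemma bernoulli_le (R : realFieldType) (x : R) n :
  0 <= x <= 1 -> 1 - n%:R * x <= (1 - x) ^+ n.
Proof.
move=> /andP[x0 x1]; elim: n => [|n IH]; first by rewrite mul0r subr0.
rewrite exprS; apply: (@le_trans _ _ ((1 - x) * (1 - n%:R * x))).
  rewrite -natr1; have n0 : 0 <= n%:R * x ^+ 2 by rewrite mulr_ge0 ?ler0n ?sqr_ge0.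
  by nra.
by rewrite ler_wpM2l // subr_ge0.
Qed.

(** With [rho = 1 - (1 - r)/(M + 1)], Bernoulli's inequality gives [rho^(M+1) >= r]. *)
Lemma root_lt1_bound (R : realFieldType) (r : R) (M : nat) : 0 <= r < 1 ->
  exists2 rho, 0 <= rho < 1 & forall m, (m <= M)%N -> r <= rho ^+ m.
Proof.
move=> /andP[r0 r1]; pose x := (1 - r) / M.+1%:R.
have x0 : 0 < x by rewrite divr_gt0 ?ltr0n // subr_gt0.
have Mx : M.+1%:R * x = 1 - r by rewrite mulrC divfK // pnatr_eq0.
have x1 : x <= 1.
  apply: (@le_trans _ _ (M.+1%:R * x)); last by lra.
  by rewrite ler_peMl ?ler1n // ltW.
exists (1 - x); first by lra.
move=> m le_mM; have x01 : 0 <= x <= 1 by lra.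
have := @bernoulli_le R x M.+1 x01; rewrite Mx => bern.
apply: (@le_trans _ _ ((1 - x) ^+ M.+1)); first by lra.
by apply: ler_wiXn2l; [lra|lra|exact: leqW].
Qed.

Lemma sum_delta_inj (K : fieldType) (I : finType) (T : eqType) (m : I -> T)
  (x : I -> K) i : injective m -> \sum_j (m i == m j)%:R * x j = x i.
Proof.
move=> m_inj; rewrite (bigD1 i) //= eqxx mul1r big1 ?addr0 // => j ne_j.
by rewrite (inj_eq m_inj) eq_sym (negPf ne_j) mul0r.
Qed.

Lemma sum_delta_notin (K : fieldType) (I : finType) (T : eqType) (m : I -> T)
  (x : I -> K) t : (forall j, t != m j) -> \sum_j (t == m j)%:R * x j = 0.
Proof. by move=> t_m; rewrite big1 // => j _; rewrite (negPf (t_m j)) mul0r. Qed.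

(** * Elements and classes of [Gamma] *)

Section UnitElements.
Variables (R : realType) (K : fieldType) (v : K -> R).
Hypothesis v_abs : is_ultrametric_abs v.

Lemma bounded_lt1 (I : finType) (c : I -> K) : (forall i, v (c i) < 1) ->
  exists2 r, 0 <= r < 1 & forall i, v (c i) <= r.
Proof.
move=> c1; exists (\big[Num.max/0]_i v (c i)); last by move=> i; exact: le_bigmax.
apply/andP; split; first exact: bigmax_ge_id.
by apply: bigmax_lt => // i _; exact: c1.
Qed.

Lemma sone_le_exp (k : nat) : v (sone K k%:Z) <= (0 : R) ^+ k.
Proof.
by case: k => [|k]; rewrite /sone /sconst /= ?(v1 v_abs) ?(v0 v_abs) ?exprn_ge0.
Qed.

Lemma Gamma0_sone : Gamma_rho v 0 (sone K).
Proof.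
apply: Gamma_one_unit => //; [by rewrite lexx ltr01|exact: one_unit_sone|].
exact: sone_le_exp.
Qed.

Lemma units_sone (S : set (int -> K)) : S (sone K) -> units v S (sone K).
Proof. by move=> S1; split=> //; exists (sone K) => //; exact: smul1s. Qed.

Lemma analytic_closure_sone A : A (sone K) -> analytic_closure v A (sone K).
Proof.
move=> A1; have [[H1 _] _ _ _] := Gamma0_sone; split=> // e e0.
exists (sone K) => //; apply: le_lt_trans e0; apply: ge_sup.
  by exists (v ((sone K - sone K) 0)), 0.
by move=> _ [i _ <-] /=; rewrite subrr (v0 v_abs).
Qed.

Lemma Gamma_sub_sone A : A (sone K) -> Gamma_sub v A (sone K).
Proof.
move=> A1; exists (sone K).
  split; first exact/units_sone/analytic_closure_sone.
  by exists 0; [rewrite /= lexx ltr01|exact: Gamma0_sone].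
by exists (sone K); [exact: Gamma0_sone|exact: smul1s].
Qed.

(** Turns an equality of classes into a factorization [h = h' (a b)]. *)
Lemma Gamma_class_refl A h : A (sone K) -> Gamma_class v A h h.
Proof.
by move=> A1; exists (sone K); [exact: Gamma_sub_sone|exact: smuls1].
Qed.

Lemma Gamma_rho_le1 rho f i : Gamma_rho v rho f -> v (f i) <= 1.
Proof. by move=> [[[[M fM] _] _] <- _ _]; exact: le_snorm fM. Qed.

Lemma Gamma0_pos f n : Gamma_rho v 0 f -> 0 < n -> f n = 0.
Proof.
move=> [_ _ _ f_exp]; case: n => [[|n]|n] // _; apply/eqP.
rewrite -(v_eq0 v_abs) eq_le (vge0 v_abs) andbT.
by apply: le_trans (f_exp n.+1 isT) _; rewrite exprS mul0r.
Qed.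

Lemma Hfield_cvg f : Hfield v f -> forall e, 0 < e ->
  exists N, forall n : nat, (N <= n)%N -> v (f n%:Z) < e.
Proof. by move=> [_ f_cvg]; exact/(cvg_to0P (fun n => vge0 v_abs _)). Qed.

End UnitElements.

Theorem proposition3p7 (R : realType) (p : nat) (p_prime : prime p)
    (Qp : fieldType) (vp : Qp -> R) (Qp_padic : is_padic_field p vp)
    (K : fieldExtType Qp) (v : K -> R) (v_abs : is_ultrametric_abs v)
    (v_ext : forall x : Qp, v (x%:A) = vp x)
    (A : set (int -> K)) (A_alg : is_subalgebra v A)
    (A_const : A `&` laurent_int = range sconst)
    (g : nat)
    (A_dim : quotient_dim laurent [set a + b | a in A & b in laurent_int] g)
    (A_int : strictly_integral v A)
    (mu : g.-tuple nat) (mu_gap : is_gap_sequence A mu) :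
  set_fun (max_ideal_pow v g) (Gamma_quot v A)
    (fun pi => Gamma_class v A (h_mu v p mu pi)) /\
  set_inj (max_ideal_pow v g)
    (fun pi => Gamma_class v A (h_mu v p mu pi)).
Proof.
have v_ratr (q : rat) : v (ratr q) = padic_abs R p q.
  by rewrite -(fmorph_rat (GRing.in_alg K)) /= v_ext (padic_ratr Qp_padic).
have v_complete : abs_complete v.
  exact (finite_ext_complete (padic_is_abs Qp_padic) (padic_complete Qp_padic) v_abs v_ext).
have A1 := subalg_one A_alg.
have [mu_sorted mu_mem] := mu_gap.
(* The unit of [A] has degree [0], which is therefore not a gap. *)
have mu_gt0 i : (0 < tnth mu i)%N.
  rewrite lt0n; apply/negP => /eqP mu0.
  have /mu_mem : 0%N \in val mu by rewrite -mu0 mem_tnth.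
  apply; exists (sone K) => //; split; first by rewrite /sone /sconst /= oner_eq0.
  by move=> n n0; rewrite /sone /sconst gt_eqF.
have mu_inj : injective (tnth mu).
  by apply/tuple_uniqP; exact: (sorted_uniq ltn_trans ltnn mu_sorted).
have h_muE pi : h_mu v p mu pi = h_prod p v (tnth mu) (index_enum 'I_g) pi by [].
have h_le_exp pi : max_ideal_pow v g pi ->
    exists2 rho, 0 <= rho < 1 & forall k : nat, v (h_mu v p mu pi k%:Z) <= rho ^+ k.
  move=> pi1; have [r r01 pi_r] := bounded_lt1 pi1.
  (* The radius must satisfy [r <= rho^mu_i] for all [i], hence the largest gap as the bound on
     exponents. *)
  have [rho rho01 r_le] := root_lt1_bound (\max_i tnth mu i) r01.
  exists rho => // k; rewrite h_muE; apply: h_prod_le_exp => //; first by case/andP: rho01.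
  by move=> i; apply: le_trans (pi_r i) (r_le _ _); exact: leq_bigmax.
split.
  move=> pi pi1; exists (h_mu v p mu pi) => //.
  have [rho rho01 h_le] := h_le_exp pi pi1; exists rho => //.
  by apply: Gamma_one_unit => //; rewrite h_muE; exact: h_prod_one_unit.
move=> pi pi'; rewrite !inE => pi1 pi'1 eq_class; apply/funext => i.
apply/eqP/negP => /negP ne_i.
have [r2 r201 pi_r2] := bounded_lt1 pi1.
have [r3 r301 pi'_r3] := bounded_lt1 pi'1.
pose r := Num.max r2 r3.
have pi_r j : v (pi j) <= r by rewrite le_max pi_r2.
have pi'_r j : v (pi' j) <= r by rewrite le_max pi'_r3 orbT.
have r1 : r < 1 by rewrite gt_max; case/andP: r201 => _ ->; case/andP: r301.
have r0 : 0 <= r by rewrite le_max; case/andP: r201 => ->.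
pose F j := v (pi j - pi' j).
case: (@arg_maxP _ _ _ i xpredT F isT) => i0 _ i0_max.
pose d := F i0.
have d_max j : F j <= d by exact: i0_max.
(* The index [i] at which [pi] and [pi'] differ makes the maximum [d] positive. *)
have d_gt0 : 0 < d by apply: lt_le_trans (d_max i); rewrite /F (v_gt0 v_abs) subr_eq0.
have dr_lt : d * r < d by rewrite -[ltRHS]mulr1 ltr_pM2l.
set h := h_mu v p mu pi in eq_class *; set h' := h_mu v p mu pi' in eq_class *.
have h_unit : one_unit h by rewrite /h h_muE; exact: h_prod_one_unit.
have h'_unit : one_unit h' by rewrite /h' h_muE; exact: h_prod_one_unit.
have h_diff n : v (h n%:Z - h' n%:Z -
    \sum_(j < g) (n == tnth mu j)%:R * (pi j - pi' j)) <= d * r.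
  exact (h_prod_diff p_prime v_abs v_ratr mu_gt0 (index_enum 'I_g) n r0 (ltW r1)
    (ltW d_gt0) pi_r pi'_r d_max).
have h'_r k : (0 < k)%N -> v (h' k%:Z) <= r.
  exact (h_prod_le p_prime v_abs v_ratr mu_gt0 (index_enum 'I_g) r0 (ltW r1) pi'_r).
have [rho' rho'01 h'_exp] := h_le_exp pi' pi'1; rewrite -/h' in h'_exp.
clearbody h h'.
have h'_cvg := Hfield_cvg v_abs (Hfield_of_le_exp v_abs rho'01 h'_unit.1 h'_exp).
have sum_gap := sum_delta_inj (fun j => pi j - pi' j) i0 mu_inj.
have sum_nongap n : n \notin val mu ->
    \sum_(j < g) (n == tnth mu j)%:R * (pi j - pi' j) = 0.
  move=> n_mu; apply: (sum_delta_notin (fun j => pi j - pi' j)) => j.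
  by apply: contraNneq n_mu => ->; exact: mem_tnth.
(* The gaps being distinct, the linear part in degree [mu_i0] is the single term [pi_i0 - pi'_i0],
   which dominates the error. *)
have h_diff_gap : v (h (tnth mu i0)%:Z - h' (tnth mu i0)%:Z) = d.
  apply: (v_dominant v_abs); apply: le_lt_trans dr_lt.
  by rewrite -sum_gap; exact: h_diff.
have h_diff_nongap n : n \notin val mu -> v (h n%:Z - h' n%:Z) <= d * r.
  by move=> /sum_nongap n_mu; have := h_diff n; rewrite n_mu subr0.
have : Gamma_class v A h' h by rewrite -eq_class; exact: Gamma_class_refl.
case=> _ [a [[aA _] [rho _ a_rho]] [b b_rho <-]] h_eq.
have [[aH _] _ _ _] := a_rho; have [_ _ b0 _] := b_rho.
have b_pos n : 0 < n -> b n = 0 by exact: (Gamma0_pos v_abs b_rho).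
have a_cvg := Hfield_cvg v_abs aH.
have a_le1 j := Gamma_rho_le1 j a_rho.
have b_le1 j := Gamma_rho_le1 j b_rho.
(* Used twice: with [alpha = 0] it yields a nonzero coefficient of [a] in positive degree, and with
   [alpha = |a_nu|] it yields [d <= |a_nu|]. *)
have diff_bound alpha : 0 <= alpha ->
    (forall n : nat, (0 < n)%N -> v (a n%:Z) <= alpha) -> d <= alpha.
  move=> alpha0 a_le; rewrite -h_diff_gap.
  exact: (diff_le v_abs v_complete r0 r1 h_unit h'_unit h'_r h'_cvg a_le1 a_cvg
    b_le1 b_pos (esym h_eq) alpha0 a_le).
have [[n [n0 an0]]|a0] := pselect (exists n : nat, (0 < n)%N /\ 0 < v (a n%:Z)); last first.
  suff : d <= 0 by rewrite leNgt d_gt0.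
  by apply: diff_bound => // n n0; rewrite leNgt; apply/negP => an0; apply: a0; exists n.
have [nu [nu0 a_nu a_max [c c_lt a_c]]] := max_positive_index a_cvg n0 an0.
have nu_mu : nu \notin val mu.
  apply/negP => /mu_mem gap; have /andP[c0] := c_lt; rewrite ltNge => /negP; apply.
  exact: (analytic_closure_gap v_abs A_int aA gap a_c c0).
(* Outside the gaps the difference is at most [d r], whereas at [nu] its absolute value is
   [|a_nu| >= d]. *)
have diff_nu := diff_eq v_abs v_complete r0 r1 h_unit h'_unit h'_r h'_cvg a_le1 a_cvg
  b_le1 b_pos b0 (esym h_eq) (ltW a_nu) a_max nu0 erefl c_lt a_c.
have := h_diff_nongap nu nu_mu; rewrite diff_nu leNgt => /negP; apply.
exact: lt_le_trans dr_lt (diff_bound _ (ltW a_nu) a_max).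
Qed.
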